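(* Let $X$ be an infinite-dimensional complex Banach space and let $T\in\mathcal{B}(X)$. The following statements are equivalent: (i) $T$ satisfies property $(Z_{\Pi_a})$; (ii) $T$ satisfies property $(gab)$ and $\sigma_{BW}(T)=\sigma_{W}(T)$; (iii) $T$ satisfies property $(ab)$ and $\Pi_a(T)=\Pi_a^0(T)$; (iv) $T$ satisfies property $(Bab)$ and $\Pi_a(T)=\Pi_a^0(T)$; (v) $T$ satisfies Browder's theorem and $\Pi_a(T)=\Pi^0(T)$.
   Context: $\mathcal{B}(X)$ is the algebra of bounded linear operators on $X$ and $I$ is the identity. For a bounded operator $S$, $\mathcal{N}(S)$ and $\mathcal{R}(S)$ are its null space and range, $\sigma(S)$ its spectrum, and $\sigma_a(S)$ its approximate point spectrum ($\lambda\in\sigma_a(S)$ iff $S-\lambda I$ is not bounded below). A bounded operator $S$ on a Banach space (possibly finite-dimensional) is Fredholm if $\dim\mathcal{N}(S)<\infty$ and $\operatorname{codim}\mathcal{R}(S)<\infty$, with index $\operatorname{ind}(S)=\dim\mathcal{N}(S)-\operatorname{codim}\mathcal{R}(S)$; it is Weyl if it is Fredholm of index $0$. The Weyl spectrum is $\sigma_W(T)=\{\lambda\in\mathbb{C}: T-\lambda I \text{ is not Weyl}\}$. An operator $S\in\mathcal{B}(X)$ is B-Weyl if for some integer $n\ge 0$ the range $\mathcal{R}(S^n)$ is closed and the restriction $S_{[n]}:\mathcal{R}(S^n)\to\mathcal{R}(S^n)$ of $S$ is Weyl. The B-Weyl spectrum is $\sigma_{BW}(T)=\{\lambda\in\mathbb{C}: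 T-\lambda I\text{ is not B-Weyl}\}$. The ascent and descent of $S$ are $a(S)=\inf\{n\in\mathbb{N}:\mathcal{N}(S^n)=\mathcal{N}(S^{n+1})\}$ and $\delta(S)=\inf\{n\in\mathbb{N}:\mathcal{R}(S^n)=\mathcal{R}(S^{n+1})\}$, with $\mathbb{N}=\{0,1,2,\dots\}$ and $\inf\emptyset=\infty$. $\lambda\in\sigma(T)$ is a pole of $T$ if $T-\lambda I$ has finite ascent and finite descent. $\lambda\in\sigma_a(T)$ is a left pole of $T$ if $a(T-\lambda I)<\infty$ and $\mathcal{R}((T-\lambda I)^{a(T-\lambda I)+1})$ is closed. A pole or left pole $\lambda$ is of finite rank if $\dim\mathcal{N}(T-\lambda I)<\infty$. $\Pi^0(T)$ is the set of poles of $T$ of finite rank, $\Pi_a(T)$ the set of left poles of $T$, and $\Pi_a^0(T)$ the set of left poles of $T$ of finite rank. $T$ satisfies: property $(Z_{\Pi_a})$ if $\sigma(T)\setminus\sigma_W(T)=\Pi_a(T)$; property $(gab)$ if $\sigma(T)\setminus\sigma_{BW}(T)=\Pi_a(T)$; property $(ab)$ if $\sigma(T)\setminus\sigma_W(T)=\Pi_a^0(T)$; property $(Bab)$ if $\sigma(T)\setminus\sigma_{BW}(T)=\Pi_a^0(T)$; Browder's theorem if $\sigma(T)\setminus\sigma_W(T)=\Pi^0(T)$. *)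

(* Defs.v *)
From HB Require Import structures.
From mathcomp Require Import all_boot all_order all_algebra.
From mathcomp Require Import complex.
From mathcomp Require Import boolp classical_sets functions reals topology normedtype.

Set Implicit Arguments.
Unset Strict Implicit.
Unset Printing Implicit Defensive.

Import Order.TTheory GRing.Theory Num.Theory.
Import numFieldNormedType.Exports.

Local Open Scope classical_set_scope.
Local Open Scope ring_scope.
Local Open Scope complex_scope.

(* Infimum of a set of naturals, with [None] standing for [inf set0 = oo]. *)
Definition nat_inf (P : set nat) : option nat :=
  if pselect (exists n, `[< P n >]) is left exP then Some (ex_minn exP)
  else None.

Lemma nat_inf_SomeP (P : set nat) (n : nat) :
  nat_inf P = Some n <-> P n /\ forall m, P m -> (n <= m)%N.
Proof.
rewrite /nat_inf; case: pselect => [exP|nexP]; last first.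
  by split=> // -[Pn _]; case: nexP; exists n; apply/asboolP.
case: ex_minnP => k /asboolP Pk minP; split=> [[<-]|[Pn minn]].
  by split=> // m Pm; apply: minP; apply/asboolP.
congr Some; apply/eqP; rewrite eqn_leq minn// andbT.
by apply: minP; apply/asboolP.
Qed.

Lemma nat_inf_NoneP (P : set nat) : nat_inf P = None <-> P = set0.
Proof.
rewrite /nat_inf; case: pselect => [exP|nexP]; split=> //.
  by have [n /asboolP Pn] := exP; move=> /seteqP[/(_ n Pn)].
by move=> _; rewrite -subset0 => n Pn; apply: nexP; exists n; apply/asboolP.
Qed.

Section Dimension.
Context {K : fieldType} {V : lmodType K}.
Implicit Types M N : set V.

(* For linear subspaces N `<=` M, the vectors e_0, ..., e_(n-1) of M induce a
   basis of the quotient space M / N. *)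
Definition quot_dim_is M N (n : nat) : Prop :=
  exists e : 'I_n -> V, (forall i, M (e i)) /\
    forall x, M x -> exists! c : 'rV[K]_n, N (x - \sum_i c 0 i *: e i).

Definition fin_codim_in M N : Prop := exists n, quot_dim_is M N n.

(* Only meaningful when [fin_codim_in M N]; the default value 0 is junk. *)
Definition codim_in M N : nat := xget 0%N (quot_dim_is M N).

Definition fin_dim M : Prop := fin_codim_in M [set 0].
Definition dim M : nat := codim_in M [set 0].

Definition nullspace (S : V -> V) : set V := [set x | S x = 0].

(* The restriction of S to an S-invariant subspace M, as an operator M -> M,
   has null space [nullspace S `&` M] and range [S @` M], the latter having its
   codimension computed in M. *)
Definition fredholm_on M (S : {linear V -> V}) : Prop :=
  fin_dim (nullspace S `&` M) /\ fin_codim_in M (S @` M).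

Definition index_on M (S : {linear V -> V}) : int :=
  (dim (nullspace S `&` M))%:Z - (codim_in M (S @` M))%:Z.

Definition weyl_on M (S : {linear V -> V}) : Prop :=
  fredholm_on M S /\ index_on M S = 0.

Definition weyl (S : {linear V -> V}) : Prop := weyl_on [set: V] S.

Definition ascent (S : {linear V -> V}) : option nat :=
  nat_inf [set n | nullspace (iter n S) = nullspace (iter n.+1 S)].

Definition descent (S : {linear V -> V}) : option nat :=
  nat_inf [set n | range (iter n S) = range (iter n.+1 S)].

Definition sub_scalar (T : {linear V -> V}) (lambda : K) : {linear V -> V} :=
  T \- lambda \*: idfun.

Lemma sub_scalarE T lambda x : sub_scalar T lambda x = T x - lambda *: x.
Proof. by []. Qed.

End Dimension.

Section Spectra.
Context {R : realType} {X : completeNormedModType R[i]}.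
Implicit Types (S T : {linear X -> X}) (lambda : R[i]).

(* The norm of X takes its values in R[i]; as [0 <= z] in R[i] forces z to be
   real, these are nonnegative reals, and so are the constants below. *)
Definition bounded_op S : Prop :=
  exists M : R[i], 0 <= M /\ forall x, `|S x| <= M * `|x|.

Definition bounded_below S : Prop :=
  exists c : R[i], 0 < c /\ forall x, c * `|x| <= `|S x|.

Definition invertible_op S : Prop :=
  exists U : {linear X -> X}, [/\ bounded_op U, cancel S U & cancel U S].

Definition bweyl S : Prop :=
  exists n : nat, closed (range (iter n S)) /\ weyl_on (range (iter n S)) S.

Definition spectrum T : set R[i] := [set l | ~ invertible_op (sub_scalar T l)].
Definition ap_spectrum T : set R[i] := [set l | ~ bounded_below (sub_scalar T l)].
Definition weyl_spectrum T : set R[i] := [set l | ~ weyl (sub_scalar T l)].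
Definition bweyl_spectrum T : set R[i] := [set l | ~ bweyl (sub_scalar T l)].

Definition pole T lambda : Prop :=
  [/\ spectrum T lambda, ascent (sub_scalar T lambda) <> None
    & descent (sub_scalar T lambda) <> None].

Definition left_pole T lambda : Prop :=
  ap_spectrum T lambda /\
  exists a : nat, ascent (sub_scalar T lambda) = Some a /\
    closed (range (iter a.+1 (sub_scalar T lambda))).

Definition finite_rank T lambda : Prop := fin_dim (nullspace (sub_scalar T lambda)).

Definition Pi0 T : set R[i] := [set l | pole T l /\ finite_rank T l].
Definition Pi_a T : set R[i] := [set l | left_pole T l].
Definition Pi_a0 T : set R[i] := [set l | left_pole T l /\ finite_rank T l].

Definition property_Z_Pi_a T : Prop :=
  spectrum T `\` weyl_spectrum T = Pi_a T.
Definition property_gab T : Prop :=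
  spectrum T `\` bweyl_spectrum T = Pi_a T.
Definition property_ab T : Prop :=
  spectrum T `\` weyl_spectrum T = Pi_a0 T.
Definition property_Bab T : Prop :=
  spectrum T `\` bweyl_spectrum T = Pi_a0 T.
Definition browder_theorem T : Prop :=
  spectrum T `\` weyl_spectrum T = Pi0 T.

End Spectra.

(* Main.v *)
Require Import Defs.
From HB Require Import structures.
From mathcomp Require Import all_boot all_order all_algebra.
From mathcomp Require Import complex.
From mathcomp Require Import ring lra.
From mathcomp Require Import boolp classical_sets functions reals topology normedtype.

Set Implicit Arguments.
Unset Strict Implicit.
Unset Printing Implicit Defensive.

Import Order.TTheory GRing.Theory Num.Theory.
Import numFieldNormedType.Exports.

Local Open Scope classical_set_scope.
Local Open Scope ring_scope.
Local Open Scope complex_scope.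

(** Everything rests on one implication: under (i), an [l] of the spectrum at
    which [S = T - l] is B-Weyl is a left pole ([Z_Pi_a_bweyl]). It makes the
    B-Weyl and Weyl spectra coincide, and the rest is bookkeeping with finite
    ascents and descents.

    Let [M = R(S^n)] be closed with [S] of index zero on [M]. The operator [S] is
    still of index zero on every later range, so these ranges are closed
    ([nclosed_ranges]). If the kernel of [S] met all of them nontrivially, then,
    the kernel in [M] being of finite dimension, it would contain a nonzero vector
    of their intersection, the hyperrange [H], which [S] maps onto itself
    ([hyperrange_onto]). By the open mapping theorem both facts persist for [S - mu] with [mu] small: it maps [H]
    onto [H] with a nonzero kernel, hence has infinite ascent. But [S - mu] is
    also of index zero on [M] ([is_weyl_perturb]), and on the whole space when
    [mu != 0] ([is_weyl_shift]); so [l + mu] is a Weyl point of the spectrum, a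
    left pole by (i), and has finite ascent: a contradiction ([bweyl_ascent]).
    Thus [S] has finite ascent; index zero turns this into finite descent, the
    ranges are eventually constant and closed, and [l] is a left pole
    ([bweyl_left_pole]).

    Stability of the index comes from a complement [F] of the range of [A] on
    [M]: the index of [A - mu] is the dimension of the preimage of [F] minus the
    dimension of [F] as long as [(A - mu) M + F = M], and that preimage keeps its
    dimension because its vectors are close to the kernel of [A] ([gap_dim_eq]).

    Among the remaining implications, (iv) to (v) uses that a B-Weyl operator of
    finite ascent has finite descent, and that a pole of finite rank is a Weyl
    point, because the index can be followed down the ranges [R(S^k)]
    ([is_weyl_image]). *)

(** * Dimensions of quotients of subspaces *)

Section QuotientDimension.
Context {K : fieldType} {V : lmodType K}.
Implicit Types (M N P : set V) (f S : {linear V -> V}).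

Definition lsubspace M := M 0 /\ forall (a : K) x y, M x -> M y -> M (a *: x + y).

Lemma lsubspace0 M : lsubspace M -> M 0. Proof. by case. Qed.

Lemma lsubspaceD M x y : lsubspace M -> M x -> M y -> M (x + y).
Proof. by move=> [_ h] Mx My; rewrite -(scale1r x); apply: h. Qed.

Lemma lsubspaceZ M a x : lsubspace M -> M x -> M (a *: x).
Proof. by move=> [M0 h] Mx; rewrite -(addr0 (_ *: _)); apply: h. Qed.

Lemma lsubspaceN M x : lsubspace M -> M x -> M (- x).
Proof. by move=> sM Mx; rewrite -scaleN1r; apply: lsubspaceZ. Qed.

Lemma lsubspaceB M x y : lsubspace M -> M x -> M y -> M (x - y).
Proof. by move=> sM Mx My; apply: lsubspaceD => //; apply: lsubspaceN. Qed.

Lemma lsubspace_sum M (I : Type) (r : seq I) (Q : pred I) (F : I -> V) :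
  lsubspace M -> (forall i, Q i -> M (F i)) -> M (\sum_(i <- r | Q i) F i).
Proof.
move=> sM h; apply: (big_ind M) => //; first exact: lsubspace0.
by move=> x y; apply: lsubspaceD.
Qed.

Lemma lsubspace_set0 : lsubspace [set 0].
Proof. by split=> // a x y /= -> ->; rewrite scaler0 addr0. Qed.

Lemma set0_sub M : lsubspace M -> [set 0] `<=` M.
Proof. by move=> sM _ /= ->; exact: lsubspace0. Qed.

Lemma lsubspaceT : lsubspace [set: V]. Proof. by []. Qed.

Lemma lsubspaceI M N : lsubspace M -> lsubspace N -> lsubspace (M `&` N).
Proof.
by move=> [M0 hM] [N0 hN]; split=> // a x y [? ?] [? ?]; split; [apply: hM|apply: hN].
Qed.

Lemma lsubspace_ker f : lsubspace (nullspace f).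
Proof.
split; rewrite /nullspace /= ?linear0// => a x y fx fy.
by rewrite linearP fx fy scaler0 addr0.
Qed.

Lemma lsubspace_image f M : lsubspace M -> lsubspace (f @` M).
Proof.
move=> sM; split; first by exists 0; [exact: lsubspace0|rewrite linear0].
move=> a _ _ [x Mx <-] [y My <-]; exists (a *: x + y); last by rewrite linearP.
by apply: lsubspaceD => //; apply: lsubspaceZ.
Qed.

Definition lincomb n (e : 'I_n -> V) (c : 'rV[K]_n) : V := \sum_i c 0 i *: e i.

Lemma lincombP n (e : 'I_n -> V) a c d :
  lincomb e (a *: c + d) = a *: lincomb e c + lincomb e d.
Proof.
rewrite /lincomb scaler_sumr -big_split; apply: eq_bigr => i _ /=.
by rewrite !mxE scalerDl scalerA.
Qed.

Lemma lincomb0 n (e : 'I_n -> V) : lincomb e 0 = 0.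
Proof. by rewrite /lincomb big1// => i _; rewrite mxE scale0r. Qed.

Lemma lincombB n (e : 'I_n -> V) c d :
  lincomb e (c - d) = lincomb e c - lincomb e d.
Proof. by rewrite [c - d]addrC -(scaleN1r d) lincombP scaleN1r addrC. Qed.

Lemma lincomb_in M n (e : 'I_n -> V) c :
  lsubspace M -> (forall i, M (e i)) -> M (lincomb e c).
Proof. by move=> sM he; apply: lsubspace_sum => // i _; apply: lsubspaceZ. Qed.

Lemma lincomb_lin f n (e : 'I_n -> V) c : f (lincomb e c) = lincomb (f \o e) c.
Proof. by rewrite /lincomb linear_sum; apply: eq_bigr => i _; rewrite linearZ. Qed.

Definition indep_mod N n (e : 'I_n -> V) := forall c, N (lincomb e c) -> c = 0.

Definition basis_mod M N n (e : 'I_n -> V) :=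
  [/\ forall i, M (e i), indep_mod N e
    & forall x, M x -> exists c, N (x - lincomb e c)].

Lemma quot_dimP M N n : lsubspace M -> lsubspace N ->
  quot_dim_is M N n <-> exists e : 'I_n -> V, basis_mod M N e.
Proof.
move=> sM sN; split=> -[e]; last first.
  move=> [eM ei es]; exists e; split=> // x /es[c Nc]; exists c; split=> // d Nd.
  apply/eqP; rewrite -subr_eq0; apply/eqP; apply: ei; rewrite lincombB.
  have := lsubspaceB sN Nd Nc.
  by rewrite opprB addrC addrA subrK.
move=> [eM eu]; exists e; split=> //.
  move=> c Nc; have [d [_ du]] := eu 0 (lsubspace0 sM).
  rewrite -(du 0) ?(du c)//.
    by rewrite sub0r; apply: lsubspaceN.
  by rewrite -/(lincomb _ _) lincomb0 subr0; exact: lsubspace0.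
by move=> x /eu[c [Nc _]]; exists c.
Qed.

(** Steinitz: the coordinates of the independent vectors in the spanning ones
    form a matrix with no nonzero row in its kernel. *)
Lemma indep_mod_leq M N m n (g : 'I_m -> V) (e : 'I_n -> V) :
  lsubspace N -> (forall i, M (g i)) -> indep_mod N g ->
  (forall x, M x -> exists c, N (x - lincomb e c)) -> (m <= n)%N.
Proof.
move=> sN gM gi es.
have [c hc] := @choice _ _ (fun j c => N (g j - lincomb e c)) (fun j => es _ (gM j)).
pose C : 'M[K]_(m, n) := \matrix_(j < m) c j.
rewrite leqNgt; apply/negP => ltnm.
have : kermx C != 0.
  rewrite kermx_eq0 /row_free; apply: contraL ltnm => /eqP <-.
  by rewrite -leqNgt rank_leq_col.
case/rowV0Pn => v /sub_kermxP vC /negP; apply; apply/eqP/gi.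
suff -> : lincomb g v = \sum_j v 0 j *: (g j - lincomb e (c j)).
  by apply: lsubspace_sum => // j _; apply: lsubspaceZ.
rewrite (eq_bigr _ (fun j _ => scalerBr _ _ _)) sumrB -[LHS]subr0; congr (_ - _).
transitivity (lincomb e (v *m C)); first by rewrite vC lincomb0.
rewrite /lincomb.
under [RHS]eq_bigr => j _ do rewrite scaler_sumr.
rewrite exchange_big; apply: eq_bigr => i _ /=.
rewrite mxE scaler_suml; apply: eq_bigr => j _.
by rewrite scalerA !mxE.
Qed.

Lemma quot_dim_uniq M N m n : lsubspace M -> lsubspace N ->
  quot_dim_is M N m -> quot_dim_is M N n -> m = n.
Proof.
move=> sM sN /quot_dimP-/(_ sM sN)[g [gM gi gs]] /quot_dimP-/(_ sM sN)[e [eM ei es]].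
apply/eqP; rewrite eqn_leq.
by rewrite (indep_mod_leq sN gM gi es) (indep_mod_leq sN eM ei gs).
Qed.

(** A maximal independent family is a basis. *)
Lemma quot_dim_exists M N B : lsubspace M -> lsubspace N ->
  (forall m (g : 'I_m -> V), (forall i, M (g i)) -> indep_mod N g -> (m <= B)%N) ->
  exists2 n, (n <= B)%N & quot_dim_is M N n.
Proof.
move=> sM sN bnd.
pose Q := [pred m | `[< exists g : 'I_m -> V, (forall i, M (g i)) /\ indep_mod N g >]].
have exQ : exists m, Q m.
  exists 0%N; apply/asboolP; exists (fun=> 0); split=> [[[]]//|c _].
  by apply/rowP => -[].
have bQ m : Q m -> (m <= B)%N by move=> /asboolP[g [gM gi]]; exact: bnd gi.
case: (ex_maxnP exQ bQ) => n /asboolP[g [gM gi]] maxn.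
exists n; first exact: bnd gi.
apply/quot_dimP => //; exists g; split=> // x Mx.
apply: contrapT => nspan.
suff /maxn : Q n.+1 by rewrite ltnn.
apply/asboolP.
pose h (i : 'I_n.+1) := if unlift ord0 i is Some j then g j else x.
exists h; split=> [i|c]; first by rewrite /h; case: unliftP.
rewrite /lincomb big_ord_recl /h unlift_none.
rewrite (eq_bigr (fun i => c 0 (lift ord0 i) *: g i)); last first.
  by move=> i _; rewrite liftK.
pose d : 'rV[K]_n := \row_i c 0 (lift ord0 i).
have -> : \sum_i c 0 (lift ord0 i) *: g i = lincomb g d.
  by apply: eq_bigr => i _; rewrite mxE.
move=> Nc.
have c0 : c 0 ord0 = 0.
  apply/eqP/negPn/negP => c0; apply: nspan; exists (- (c 0 ord0)^-1 *: d).
  rewrite -[- _ *: d]addr0 lincombP lincomb0 addr0 scaleNr opprK.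
  rewrite -[x]scale1r -(mulVf c0) -scalerA -scalerDr.
  exact: lsubspaceZ.
move: Nc; rewrite c0 scale0r add0r => /gi /rowP d0.
apply/rowP => i; rewrite mxE; case: (unliftP ord0 i) => [j|] -> //.
by have := d0 j; rewrite !mxE.
Qed.

Lemma quot_dim_interm M P N n : lsubspace M -> lsubspace P -> lsubspace N ->
  N `<=` P -> P `<=` M -> quot_dim_is M N n ->
  exists a b, [/\ quot_dim_is M P a, quot_dim_is P N b & (b <= n)%N].
Proof.
move=> sM sP sN NP PM /quot_dimP-/(_ sM sN)[e [eM ei es]].
have [a _ qa] : exists2 a, (a <= n)%N & quot_dim_is M P a.
  apply: quot_dim_exists => // m g gM gi; apply: (indep_mod_leq sN gM _ es).
  by move=> c /NP /gi.
have [b leb qb] : exists2 b, (b <= n)%N & quot_dim_is P N b.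
  apply: quot_dim_exists => // m g gP gi; apply: (indep_mod_leq sN _ gi es).
  by move=> i; apply: PM.
by exists a, b.
Qed.

Lemma quot_dim_add M P N a b : lsubspace M -> lsubspace P -> lsubspace N ->
  N `<=` P -> P `<=` M -> quot_dim_is M P a -> quot_dim_is P N b ->
  quot_dim_is M N (a + b).
Proof.
move=> sM sP sN NP PM /quot_dimP-/(_ sM sP)[e [eM ei es]].
move=> /quot_dimP-/(_ sP sN)[g [gP gi gs]].
apply/quot_dimP => //.
pose h (i : 'I_(a + b)) := match fintype.split i with inl j => e j | inr j => g j end.
have hE c : lincomb h c = lincomb e (lsubmx c) + lincomb g (rsubmx c).
  rewrite /lincomb big_split_ord /=; congr (_ + _); apply: eq_bigr => i _.
    by rewrite mxE /h (unsplitK (inl i)).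
  by rewrite mxE /h (unsplitK (inr i)).
exists h; split.
- by move=> i; rewrite /h; case: fintype.split => j //; apply: PM.
- move=> c; rewrite hE => Nc.
  have l0 : lsubmx c = 0.
    apply: ei; rewrite -[lincomb e _](addrK (lincomb g (rsubmx c))).
    by apply: lsubspaceB => //; [exact: NP|exact: lincomb_in].
  move: Nc; rewrite l0 lincomb0 add0r => /gi r0.
  by rewrite -(hsubmxK c) l0 r0 row_mx0.
move=> x /es[c /gs[d Nd]]; exists (row_mx c d).
by rewrite hE row_mxKl row_mxKr opprD addrA.
Qed.

(** An operator inducing an isomorphism [M / N -> M' / N'] carries bases to
    bases and lifts them back. *)
Lemma quot_dim_iso f M N M' N' n : lsubspace M -> lsubspace N ->
  lsubspace M' -> lsubspace N' ->
  (forall x, M x -> M' (f x)) -> (forall x, N x -> N' (f x)) ->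
  (forall x, M x -> N' (f x) -> N x) ->
  (forall y, M' y -> exists2 x, M x & N' (y - f x)) ->
  quot_dim_is M N n <-> quot_dim_is M' N' n.
Proof.
move=> sM sN sM' sN' fM fN fNi fs; split.
  move=> /quot_dimP-/(_ sM sN)[e [eM ei es]]; apply/quot_dimP => //.
  exists (f \o e); split=> [i|c|y /fs[x Mx Nx]]; first exact: fM.
    by rewrite -lincomb_lin => /fNi h; apply: ei; apply: h; exact: lincomb_in.
  have [c Nc] := es _ Mx; exists c; rewrite -lincomb_lin.
  rewrite -(subrK (f x) y) -addrA -linearB; apply: lsubspaceD => //; exact: fN.
move=> /quot_dimP-/(_ sM' sN')[e [eM ei es]]; apply/quot_dimP => //.
have /choice[g hg] : forall i, exists x, M x /\ N' (e i - f x).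
  by move=> i; have [x Mx Nx] := fs _ (eM i); exists x.
have gM i : M (g i) by case: (hg i).
have eg c : N' (lincomb e c - f (lincomb g c)).
  rewrite lincomb_lin /lincomb -sumrB; apply: lsubspace_sum => // i _.
  by rewrite -scalerBr; apply: lsubspaceZ => //; case: (hg i).
exists g; split=> // [c Nc|x Mx].
  apply: ei; rewrite -[lincomb e c](subrK (f (lincomb g c))).
  by apply: lsubspaceD => //; exact: fN.
have [c Nc] := es _ (fM _ Mx); exists c; apply: fNi.
  by apply: lsubspaceB => //; exact: lincomb_in.
rewrite linearB -(subrK (lincomb e c) (f x)) -addrA; exact: lsubspaceD.
Qed.

Lemma quot_dim0 M N : lsubspace M -> lsubspace N -> quot_dim_is M N 0 <-> M `<=` N.
Proof.
move=> sM sN; split=> [/quot_dimP-/(_ sM sN)[e [_ _ es]] x /es[c]|MN].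
  by rewrite /lincomb big_ord0 subr0.
apply/quot_dimP => //; exists (fun=> 0); split=> [[]|c _|x Mx] //.
  by apply/rowP => -[].
move/MN: Mx => Nx; by exists 0; rewrite lincomb0 subr0.
Qed.

Lemma codim_inE M N n : lsubspace M -> lsubspace N -> quot_dim_is M N n ->
  codim_in M N = n.
Proof.
move=> sM sN qn; apply: (quot_dim_uniq sM sN) (qn).
exact: (xgetPex 0%N (ex_intro _ n qn)).
Qed.

Lemma fin_codim_complement M N n : lsubspace M -> lsubspace N ->
  quot_dim_is M N n -> exists F, [/\ lsubspace F, F `<=` M, quot_dim_is F [set 0] n,
    F `&` N `<=` [set 0] & forall y, M y -> exists2 f, F f & N (y - f)].
Proof.
move=> sM sN /quot_dimP-/(_ sM sN)[e [eM ei es]].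
pose F := range (lincomb e).
have sF : lsubspace F.
  split; first by exists 0; rewrite ?lincomb0.
  by move=> a _ _ [c _ <-] [d _ <-]; exists (a *: c + d); rewrite ?lincombP.
exists F; split=> //.
- by move=> _ [c _ <-]; exact: lincomb_in.
- apply/(quot_dimP _ sF lsubspace_set0); exists e; split.
  + move=> i; exists (delta_mx 0 i) => //; rewrite /lincomb (bigD1 i)//= big1 => [|j ji].
      by rewrite addr0 mxE !eqxx scale1r.
    by rewrite mxE (negbTE ji) andbF scale0r.
  + by move=> c /= c0; apply: ei; rewrite c0; exact: lsubspace0.
  + by move=> _ [c _ <-]; exists c; rewrite /= subrr.
- by move=> _ [[c _ <-] /ei ->]; rewrite /= lincomb0.
- by move=> y /es[c Nc]; exists (lincomb e c) => //; exists c.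
Qed.

Lemma fin_dim_sub M N : lsubspace M -> lsubspace N -> N `<=` M ->
  fin_dim M -> fin_dim N.
Proof.
move=> sM sN NM [n qn].
have [_ [b [_ qb _]]] := quot_dim_interm sM sN lsubspace_set0 (set0_sub sN) NM qn.
by exists b.
Qed.

End QuotientDimension.

(** * Index, ascent and descent *)

Section WeylAlgebra.
Context {K : fieldType} {V : lmodType K}.
Implicit Types (M N P H : set V) (S B : {linear V -> V}).

(** [weyl_on] as a relation, free of the default value of [codim_in]. *)
Definition is_weyl M S := exists n,
  quot_dim_is (nullspace S `&` M) [set 0] n /\ quot_dim_is M (S @` M) n.

Lemma lsubspace_nullI M S : lsubspace M -> lsubspace (nullspace S `&` M).
Proof. by move=> sM; apply: lsubspaceI => //; exact: lsubspace_ker. Qed.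

Lemma weyl_onP M S : lsubspace M -> weyl_on M S <-> is_weyl M S.
Proof.
move=> sM.
have sN := lsubspace_nullI S sM; have sI := lsubspace_image S sM.
have s0 := @lsubspace_set0 K V.
split=> [[[[a qa] [b qb]]]|[n [qN qI]]].
  rewrite /index_on /Defs.dim (codim_inE sN s0 qa) (codim_inE sM sI qb).
  by move/eqP; rewrite subr_eq0 => /eqP[ab]; exists a; split=> //; rewrite ab.
split; first by split; exists n.
by rewrite /index_on /Defs.dim (codim_inE sN s0 qN) (codim_inE sM sI qI) subrr.
Qed.

(** With [L = (ker S `&` M) + S M], the quotient [L / S M] measures how much of
    the kernel is lost in passing from [M] to [S M], while [S] identifies
    [M / L] with [S M / S^2 M]; so nullity and defect drop by the same amount. *)
Lemma is_weyl_image M S : lsubspace M -> (forall x, M x -> M (S x)) ->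
  fin_dim (nullspace S `&` M) -> is_weyl M S <-> is_weyl (S @` M) S.
Proof.
move=> sM SM fdN.
have sI := lsubspace_image S sM; have sI2 := lsubspace_image S sI.
have IM : S @` M `<=` M by move=> _ [x Mx <-]; exact: SM.
have sN0 := lsubspace_nullI S sM; have sN1 := lsubspace_nullI S sI.
have N10 : nullspace S `&` S @` M `<=` nullspace S `&` M.
  by move=> x [Sx /IM].
have [a qa] := fdN.
have s0 := @lsubspace_set0 K V.
have [k [a1 [qk qa1 _]]] := quot_dim_interm sN0 sN1 s0 (set0_sub sN1) N10 qa.
have Ea : a = (k + a1)%N.
  apply: (quot_dim_uniq sN0 s0 qa).
  exact: (quot_dim_add sN0 sN1 s0 (set0_sub sN1) N10 qk qa1).
pose L := [set x | M x /\ exists2 z, (nullspace S `&` M) z & (S @` M) (x - z)].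
have sL : lsubspace L.
  split.
    split; first exact: lsubspace0.
    by exists 0; rewrite ?subr0; exact: lsubspace0.
  move=> c x y [Mx [u Nu Iu]] [My [v Nv Iv]]; split.
    by apply: lsubspaceD => //; exact: lsubspaceZ.
  exists (c *: u + v); first by apply: lsubspaceD => //; exact: lsubspaceZ.
  rewrite opprD addrACA -scalerBr.
  by apply: lsubspaceD => //; exact: lsubspaceZ.
have IL : S @` M `<=` L.
  move=> x Ix; split; first exact: IM.
  by exists 0; rewrite ?subr0//; exact: lsubspace0.
have LM : L `<=` M by move=> x [].
have qL : quot_dim_is L (S @` M) k.
  apply: (iffLR (@quot_dim_iso _ _ idfun (nullspace S `&` M)
    (nullspace S `&` S @` M) _ _ _ _ _ _ _ _ _ _ _)) qk => //=.
  - move=> x [Sx Mx]; split=> //; exists x => //.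
    by rewrite subrr; exact: lsubspace0.
  - by move=> x [].
  - by move=> x [].
  - by move=> y [My [z Nz Iz]]; exists z.
have qML b : quot_dim_is M L b <-> quot_dim_is (S @` M) (S @` (S @` M)) b.
  apply: (@quot_dim_iso _ _ S) => //.
  - move=> x [Mx [z [Sz _] Iz]]; exists (x - z) => //.
    by rewrite linearB Sz subr0.
  - move=> x Mx [_ [z Mz <-] SSz]; split=> //; exists (x - S z); last first.
      by rewrite opprB addrC subrK; exists z.
    split; last by apply: lsubspaceB => //; exact: SM.
    by rewrite /nullspace /= linearB SSz subrr.
  - by move=> _ [x Mx <-]; exists x; rewrite ?subrr//; exact: lsubspace0.
split=> -[n [qN qI]].
  have {qN} En : n = a by exact: quot_dim_uniq sN0 s0 qN qa.
  subst n; exists a1; split=> //.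
  have [b [k' [qb qk' _]]] := quot_dim_interm sM sL sI IL LM qI.
  have Ek : k' = k by exact: quot_dim_uniq sL sI qk' qL.
  have Eb : a = (b + k')%N by exact: (quot_dim_uniq sM sI qI (quot_dim_add sM sL sI IL LM qb qk')).
  suff <- : b = a1 by apply/qML.
  by move: Eb; rewrite Ea Ek addnC => /addIn.
have {qN} En : n = a1 by exact: quot_dim_uniq sN1 s0 qN qa1.
subst n; exists a; split=> //; rewrite Ea addnC.
by apply: (quot_dim_add sM sL sI IL LM _ qL); apply/qML.
Qed.

(** The index is read off from the preimage [D] of a subspace [F] with
    [B M + F = M]: both sides of the exact sequence [0 -> ker B -> D -> F -> M / B M -> 0]
    are accounted for. *)
Lemma is_weyl_of_preimage M F B n : lsubspace M -> lsubspace F ->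
  (forall x, M x -> M (B x)) -> F `<=` M ->
  (forall y, M y -> exists2 x, M x & F (y - B x)) ->
  quot_dim_is F [set 0] n ->
  quot_dim_is [set x | M x /\ F (B x)] [set 0] n ->
  is_weyl M B.
Proof.
move=> sM sF BM FM onto qF qD.
set D := [set x | _] in qD.
have s0 := @lsubspace_set0 K V.
have sN := lsubspace_nullI B sM; have sI := lsubspace_image B sM.
have sD : lsubspace D.
  split; first by rewrite /D /= linear0; split; exact: lsubspace0.
  move=> c x y [Mx Fx] [My Fy]; split.
    by apply: lsubspaceD => //; exact: lsubspaceZ.
  by rewrite linearP; apply: lsubspaceD => //; exact: lsubspaceZ.
have ND : nullspace B `&` M `<=` D.
  by move=> x [Bx Mx]; split=> //; rewrite Bx; exact: lsubspace0.
pose G := F `&` B @` M.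
have sG : lsubspace G by apply: lsubspaceI.
have GF : G `<=` F by move=> x [].
have [b [a [qb qa _]]] := quot_dim_interm sD sN s0 (set0_sub sN) ND qD.
have [h [g [qh qg _]]] := quot_dim_interm sF sG s0 (set0_sub sG) GF qF.
have Ebg : b = g.
  apply: (quot_dim_uniq sG s0) qg.
  apply: (iffLR (@quot_dim_iso _ _ B D (nullspace B `&` M) _ _ _ _ _ _ _ _ _ _ _)) qb => //.
  - by move=> x [Mx Fx]; split=> //; exists x.
  - by move=> x [].
  - by move=> x [Mx _] Bx; split.
  - by move=> y [Fy [x Mx xy]]; exists x; [split=> //; rewrite xy|rewrite xy subrr].
exists a; split=> //.
have -> : a = h.
  apply: (@addnI b); rewrite {2}Ebg [RHS]addnC.
  have -> := quot_dim_uniq sD s0 (quot_dim_add sD sN s0 (set0_sub sN) ND qb qa) qD.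
  exact: (quot_dim_uniq sF s0 qF (quot_dim_add sF sG s0 (set0_sub sG) GF qh qg)).
apply: (iffLR (@quot_dim_iso _ _ idfun F G _ _ _ _ _ _ _ _ _ _ _)) qh => //=.
- by move=> x [].
- move=> y My; have [x Mx Fx] := onto y My; exists (y - B x) => //.
  by rewrite opprB addrC subrK; exists x.
Qed.

(** The factors [t] and [t - mu] are coprime, so the kernel of [S - mu] lies in
    [S M] and its defect is the same on [M] and on [S M]. *)
Lemma is_weyl_shift_of_image M S B (mu : K) : mu != 0 ->
  (forall x, B x = S x - mu *: x) ->
  lsubspace M -> (forall x, M x -> M (S x)) ->
  is_weyl (S @` M) B -> is_weyl M B.
Proof.
move=> mu0 hB sM SM [n [qN qI]].
have IM : S @` M `<=` M by move=> _ [x Mx <-]; exact: SM.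
have BM x : M x -> M (B x).
  by move=> Mx; rewrite hB; apply: lsubspaceB; [|exact: SM|exact: lsubspaceZ].
have BS x : B (S x) = S (B x) by rewrite !hB linearB (linearZ_LR S).
have inv x : x = mu^-1 *: (S x - B x).
  by rewrite hB opprB addrC subrK scalerA mulVf// scale1r.
have sI := lsubspace_image S sM.
have sBM := lsubspace_image B sM; have sBI := lsubspace_image B sI.
exists n; split.
  suff -> : nullspace B `&` M = nullspace B `&` S @` M by [].
  apply/seteqP; split=> x [Bx Mx]; split=> //; last exact: IM.
  exists (mu^-1 *: x); first exact: lsubspaceZ.
  by rewrite (linearZ_LR S) [RHS]inv Bx subr0.
apply: (iffLR (@quot_dim_iso _ _ idfun (S @` M) (B @` (S @` M)) _ _ _ _ _ _ _ _ _ _ _)) qI => //=.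
- by move=> _ [x /IM Mx <-]; exists x.
- move=> _ [x Mx <-] [y My Byx]; exists y => //.
  rewrite [y]inv Byx; exists (mu^-1 *: (y - x)).
    by apply: lsubspaceZ => //; exact: lsubspaceB.
  by rewrite (linearZ_LR S) linearB.
- move=> y My; exists (mu^-1 *: S y).
    by exists (mu^-1 *: y); [exact: lsubspaceZ|rewrite (linearZ_LR S)].
  exists (- (mu^-1 *: y)); first by apply: lsubspaceN => //; exact: lsubspaceZ.
  by rewrite linearN (linearZ_LR B) {2}[y]inv scalerBr addrAC subrr sub0r.
Qed.

Lemma range_iterS S k : range (iter k.+1 S) = S @` range (iter k S).
Proof.
apply/seteqP; split=> [_ [x _ <-]|_ [_ [x _ <-] <-]]; last by exists x.
by exists (iter k S x) => //; exists x.
Qed.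

Lemma range_iter0 S : range (iter 0 S) = [set: V].
Proof. by apply/seteqP; split=> // x _; exists x. Qed.

Lemma lsubspace_range S k : lsubspace (range (iter k S)).
Proof.
elim: k => [|k IH]; first by rewrite range_iter0.
by rewrite range_iterS; exact: lsubspace_image.
Qed.

Lemma range_iter_le S k m : (k <= m)%N -> range (iter m S) `<=` range (iter k S).
Proof.
by move=> /subnKC <- _ [x _ <-]; exists (iter (m - k) S x) => //; rewrite iterD.
Qed.

Lemma range_iter_stable S k x : range (iter k S) x -> range (iter k S) (S x).
Proof. by move=> kx; apply: (@range_iter_le S k k.+1) => //; rewrite range_iterS; exists x. Qed.

Lemma range_iter_const S k : range (iter k S) = range (iter k.+1 S) ->
  forall m, (k <= m)%N -> range (iter m S) = range (iter k S).
Proof.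
move=> E m /subnKC <-; elim: (m - k)%N => [|j IH]; first by rewrite addn0.
by rewrite addnS range_iterS IH -range_iterS.
Qed.

Lemma iter_linB S k x y : iter k S (x - y) = iter k S x - iter k S y.
Proof. by elim: k => //= k ->; rewrite linearB. Qed.

Lemma ascent_stepP S p : nullspace (iter p S) = nullspace (iter p.+1 S) <->
  nullspace S `&` range (iter p S) `<=` [set 0].
Proof.
split=> [E y [Sy [x _ xy]]|h].
  rewrite -xy; have : nullspace (iter p.+1 S) x by rewrite /nullspace /= xy.
  by rewrite -E.
apply/seteqP; split=> x; rewrite /nullspace /= => hx.
  by rewrite hx linear0.
by apply: h; split=> //; exists x.
Qed.

Lemma ascent_finP S : ascent S <> None <->
  exists p, nullspace S `&` range (iter p S) `<=` [set 0].
Proof.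
split=> [|[p /ascent_stepP hp] /nat_inf_NoneP/seteqP[/(_ p hp)]//].
case E : (ascent S) => [p|//] _; exists p; apply/ascent_stepP.
by have [] := (nat_inf_SomeP _ _).1 E.
Qed.

Lemma descent_finP S : descent S <> None <->
  exists d, range (iter d S) = range (iter d.+1 S).
Proof.
split=> [|[d hd] /nat_inf_NoneP/seteqP[/(_ d hd)]//].
case E : (descent S) => [d|//] _; exists d.
by have [] := (nat_inf_SomeP _ _).1 E.
Qed.

Lemma ascent_Some S a : ascent S = Some a ->
  nullspace S `&` range (iter a S) `<=` [set 0].
Proof. by move=> /nat_inf_SomeP[/ascent_stepP]. Qed.

(** [S] is injective on [R(S^a)], so for [x] in [R(S^a)] an equality
    [S^d x = S^(d + a + 1) z] can be cancelled down to [x = S^(a + 1) z]. *)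
Lemma descent_le_ascent S a d : nullspace S `&` range (iter a S) `<=` [set 0] ->
  range (iter d S) = range (iter d.+1 S) ->
  forall m, (a <= m)%N -> range (iter m S) = range (iter a S).
Proof.
move=> ha hd; apply: range_iter_const; apply/seteqP; split; last exact: range_iter_le.
move=> x ax.
have inj k y : range (iter a S) y -> iter k S y = 0 -> y = 0.
  elim: k y => [//|k IH] y ay; rewrite iterSr => /IH -/(_ (range_iter_stable ay)) Sy.
  by apply: ha; split.
have [w _ wx] := ax.
have [z _ zx] : range (iter (d + a.+1) S) (iter d S x).
  have -> : range (iter (d + a.+1) S) = range (iter (d + a) S).
    by rewrite !(@range_iter_const _ _ hd) ?leq_addr.
  by exists w => //; rewrite iterD wx.
exists z => //; apply/eqP; rewrite -subr_eq0; apply/eqP; apply: (inj d).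
  apply: lsubspaceB => //; first exact: lsubspace_range.
  by apply: (@range_iter_le S a a.+1) => //; exists z.
by rewrite iter_linB -zx iterD subrr.
Qed.

Lemma fin_dim_nullI S M : lsubspace M -> fin_dim (nullspace S) ->
  fin_dim (nullspace S `&` M).
Proof.
move=> sM; apply: fin_dim_sub; [exact: lsubspace_ker|exact: lsubspace_nullI|].
by move=> x [].
Qed.

Lemma is_weyl_range_le S n k : is_weyl (range (iter n S)) S ->
  is_weyl (range (iter (n + k) S)) S.
Proof.
move=> h; elim: k => [|k IH]; first by rewrite addn0.
have fdN : fin_dim (nullspace S `&` range (iter (n + k) S)).
  by have [m [qm _]] := IH; exists m.
rewrite addnS range_iterS.
exact: (iffLR (is_weyl_image (lsubspace_range S _) (@range_iter_stable S _) fdN)).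
Qed.

(** Index zero persists on the smaller ranges, where the nullity vanishes; so
    the defect vanishes as well. *)
Lemma weyl_ascent_descent S n p : is_weyl (range (iter n S)) S ->
  nullspace S `&` range (iter p S) `<=` [set 0] ->
  exists d, range (iter d S) = range (iter d.+1 S).
Proof.
move=> /(@is_weyl_range_le _ _ p)[m [qN qI]] hp; exists (n + p)%N.
have sR := lsubspace_range S (n + p); have s0 := @lsubspace_set0 K V.
have m0 : m = 0%N.
  apply: (quot_dim_uniq _ s0 qN); first exact: lsubspace_nullI.
  apply/quot_dim0 => //; first exact: lsubspace_nullI.
  by move=> x [Sx Rx]; apply: hp; split=> //; exact: range_iter_le (leq_addl n p) _ Rx.
apply/seteqP; split; last exact: range_iter_le.
rewrite range_iterS; apply/quot_dim0 => //; first exact: lsubspace_image.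
by rewrite -m0.
Qed.

(** Far down the ranges [S] is bijective, hence of index zero; a finite
    nullity lets this climb back up to the whole space. *)
Lemma pole_finite_rank_weyl S : fin_dim (nullspace S) ->
  ascent S <> None -> descent S <> None -> weyl S.
Proof.
move=> fdN /ascent_finP[p hp] /descent_finP[d hd].
apply/weyl_onP => //; rewrite -(range_iter0 S).
have: is_weyl (range (iter (p + d) S)) S.
  have sR := lsubspace_range S (p + d).
  exists 0%N; split.
    apply/(quot_dim0 (lsubspace_nullI S sR) lsubspace_set0) => x [Sx Rx].
    by apply: hp; split=> //; exact: range_iter_le (leq_addr d p) _ Rx.
  apply/(quot_dim0 sR (lsubspace_image S sR)).
  rewrite -range_iterS (range_iter_const hd (leq_addl _ _)).
  by rewrite (@range_iter_const S d hd (p + d).+1) // leqW // leq_addl.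
elim: (p + d)%N => // k IH; rewrite range_iterS => h; apply: IH.
have sR := lsubspace_range S k.
exact: (iffRL (is_weyl_image sR (@range_iter_stable S _) (fin_dim_nullI sR fdN))).
Qed.

Lemma weyl_ascent_finite_descent S : weyl S -> ascent S <> None -> descent S <> None.
Proof.
move=> /weyl_onP-/(_ lsubspaceT); rewrite -(range_iter0 S) => wS /ascent_finP[p hp].
exact/descent_finP/(weyl_ascent_descent wS hp).
Qed.

Lemma is_weyl_shift S B (mu : K) n : mu != 0 ->
  (forall x, B x = S x - mu *: x) -> is_weyl (range (iter n S)) B -> weyl B.
Proof.
move=> mu0 hB h; apply/weyl_onP => //; rewrite -(range_iter0 S).
elim: n h => // n IH h; apply: IH; apply: (is_weyl_shift_of_image mu0 hB).
- exact: lsubspace_range.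
- exact: range_iter_stable.
- by rewrite -range_iterS.
Qed.

Lemma kernel_range_stabilizes S n : fin_dim (nullspace S `&` range (iter n S)) ->
  exists2 q, (n <= q)%N & forall r, (q <= r)%N ->
    nullspace S `&` range (iter r S) = nullspace S `&` range (iter q S).
Proof.
move=> fdN.
have sN k := lsubspace_nullI S (lsubspace_range S k).
have s0 := @lsubspace_set0 K V.
have z0 k : [set 0] `<=` nullspace S `&` range (iter k S).
  exact: set0_sub.
have le k m : (k <= m)%N ->
    nullspace S `&` range (iter m S) `<=` nullspace S `&` range (iter k S).
  by move=> km x [Sx Rx]; split=> //; exact: range_iter_le km _ Rx.
pose Q := [pred b | `[< exists2 q, (n <= q)%N
                      & quot_dim_is (nullspace S `&` range (iter q S)) [set 0] b >]].
have exQ : exists b, Q b by have [b qb] := fdN; exists b; apply/asboolP; exists n.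
case: (ex_minnP exQ) => b /asboolP[q nq qb] minb; exists q => // r qr.
apply/seteqP; split; first exact: le.
have [c [b' [qc qb' b'b]]] := quot_dim_interm (sN q) (sN r) s0 (z0 r) (le _ _ qr) qb.
have Eb : b = (c + b')%N.
  by exact: (quot_dim_uniq (sN q) s0 qb (quot_dim_add (sN q) (sN r) s0 (z0 r) (le _ _ qr) qc qb')).
have bb' : (b <= b')%N.
  by apply: minb; apply/asboolP; exists r => //; exact: leq_trans qr.
have c0 : c = 0%N by apply/eqP; move: bb'; rewrite Eb -{2}(add0n b') leq_add2r leqn0.
by apply/quot_dim0 => //; rewrite -c0.
Qed.

Definition hyperrange S : set V := [set x | forall k, range (iter k S) x].

Lemma lsubspace_hyperrange S : lsubspace (hyperrange S).
Proof.
split=> [k|a x y hx hy k]; first exact: lsubspace0 (lsubspace_range S k).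
have sR := lsubspace_range S k.
by apply: lsubspaceD => //; exact: lsubspaceZ.
Qed.

Lemma hyperrange_stable S x : hyperrange S x -> hyperrange S (S x).
Proof. by move=> hx k; exact: range_iter_stable. Qed.

(** Two preimages of [y] differ by a kernel element; once the kernels in the
    ranges have stabilised at [q], a preimage in [R(S^q)] is in all ranges. *)
Lemma hyperrange_onto S q : (forall r, (q <= r)%N ->
    nullspace S `&` range (iter r S) = nullspace S `&` range (iter q S)) ->
  forall y, hyperrange S y -> exists2 x, hyperrange S x & S x = y.
Proof.
move=> hq y hy.
have pre k : exists2 x, range (iter k S) x & S x = y.
  by have := hy k.+1; rewrite range_iterS => -[x]; exists x.
have [x qx Sx] := pre q; exists x => // k.
apply: (range_iter_le (leq_maxr q k)).
have [z kz Sz] := pre (maxn q k).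
have /seteqP[_ sub] := hq _ (leq_maxl q k).
have [_ h] : (nullspace S `&` range (iter (maxn q k) S)) (x - z).
  apply: sub; split; first by rewrite /nullspace /= linearB Sx Sz subrr.
  apply: lsubspaceB => //; first exact: lsubspace_range.
  exact: range_iter_le (leq_maxl q k) _ kz.
by rewrite -(subrK z x); apply: lsubspaceD => //; exact: lsubspace_range.
Qed.

(** The vector [k] lies in the range of every power of [B]; a finite ascent leaves
    no such vector but zero in the kernel. *)
Lemma onto_kernel_ascent B H k : H k -> B k = 0 ->
  (forall y, H y -> exists2 x, H x & B x = y) -> ascent B <> None -> k = 0.
Proof.
move=> Hk Bk onto /ascent_finP[p]; apply; split=> //.
have : forall y, H y -> exists2 x, H x & iter p B x = y.
  elim: p => [y|p IH y /onto[x /IH[z Hz <-] <-]]; first by exists y.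
  by exists z.
by move=> /(_ _ Hk)[x _ <-]; exists x.
Qed.

End WeylAlgebra.

(** * Real-valued norms, completeness and closed sets *)

Section GeometricCauchy.
Context {K : numFieldType} {V : completeNormedModType K}.

(** A summable bound on the steps makes the sequence Cauchy. The scalars are
    arbitrary so that both [R] and spaces over [R[i]] are covered. *)
Lemma geometric_cvg (u : nat -> V) (C : K) :
  (forall e, 0 < e -> exists k, C * 2 * 2^-1 ^+ k < e) ->
  (forall k, `|u k.+1 - u k| <= C * 2^-1 ^+ k) ->
  exists l, forall k, `|l - u k| <= C * 2 * 2^-1 ^+ k.
Proof.
move=> arch hu.
have tail k j : `|u (k + j)%N - u k| <= C * 2 * 2^-1 ^+ k - C * 2 * 2^-1 ^+ (k + j).
  elim: j => [|j IH]; first by rewrite addn0 !subrr normr0.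
  have -> : u (k + j.+1)%N - u k = (u (k + j).+1 - u (k + j)%N) + (u (k + j)%N - u k).
    by rewrite addrA subrK addnS.
  apply: le_trans (ler_normD _ _) _; apply: le_trans (lerD (hu _) IH) _.
  rewrite addnS exprS le_eqVlt; apply/orP; left; apply/eqP.
  have -> : C * 2 * (2^-1 * 2^-1 ^+ (k + j)) = C * 2^-1 ^+ (k + j).
    by rewrite -!mulrA [2 * (2^-1 * _)]mulrA mulfV ?pnatr_eq0// mul1r.
  by rewrite mulr_natr mulrnAl; ring.
have C0 : 0 <= C by have := le_trans (normr_ge0 _) (hu 0%N); rewrite expr0 mulr1.
have tail' k m : (k <= m)%N -> `|u m - u k| <= C * 2 * 2^-1 ^+ k.
  move=> /subnKC <-; apply: le_trans (tail _ _) _.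
  by rewrite lerBlDr lerDl mulr_ge0 ?mulr_ge0 ?exprn_ge0 ?invr_ge0.
have /cauchy_cvgP cu : cauchy (u @ \oo).
  apply: cauchy_exP => e e0; have [k hk] := arch _ e0; exists (u k).
  exists k => // m /= km; rewrite -ball_normE /=.
  by rewrite distrC; apply: le_lt_trans hk; exact: tail'.
exists (lim (u @ \oo)) => k; apply/ler_addgt0Pr => e e0.
have /cvgrPdist_lt /(_ e e0) [N _ hN] := cu.
have := hN (maxn N k) (leq_maxl _ _) => /= /ltW h.
have -> : lim (u @ \oo) - u k
    = (u (maxn N k) - u k) + (lim (u @ \oo) - u (maxn N k)).
  by rewrite [RHS]addrC addrA subrK.
apply: le_trans (ler_normD _ _) (lerD _ h).
by apply: tail'; exact: leq_maxr.
Qed.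

End GeometricCauchy.

Lemma half_pow_arch (R : realType) (C e : R) : 0 < e -> exists k, C * 2^-1 ^+ k < e.
Proof.
move=> e0; have [C0|C0] := leP C 0.
  exists 0%N; rewrite expr0 mulr1; exact: le_lt_trans e0.
pose N := (Num.Def.trunc (C / e)).+1; exists N.
have h1 : C / e < N%:R by exact: truncnS_gt.
have h2 : (N%:R : R) < 2 ^+ N by rewrite -natrX ltr_nat ltn_expl.
rewrite exprVn ltr_pdivrMr ?exprn_gt0// mulrC -ltr_pdivrMr//.
exact: lt_trans h2.
Qed.

Section RealNorm.
Context {R : realType}.
Local Notation C := R[i].

(** The norms take values in the partially ordered field [R[i]]; their real
    parts carry the same information and live in an ordered field. *)
Definition cabs (a : C) : R := complex.Re `|a|.

Lemma norm_cabs (a : C) : `|a| = (cabs a)%:C.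
Proof. by rewrite /cabs RRe_real// ger0_real. Qed.

Lemma cabs_ge0 a : 0 <= cabs a.
Proof. by rewrite -ler0c -norm_cabs. Qed.

Lemma cabs0 : cabs 0 = 0. Proof. by apply: complexI; rewrite -norm_cabs normr0. Qed.

Lemma cabs_eq0 a : cabs a = 0 -> a = 0.
Proof. by move=> a0; apply/eqP; rewrite -normr_eq0 norm_cabs a0. Qed.

Lemma cabs_gt0 a : a != 0 -> 0 < cabs a.
Proof.
move=> a0; rewrite lt_neqAle cabs_ge0 andbT eq_sym.
by apply: contra a0 => /eqP/cabs_eq0->.
Qed.

Lemma cabs_real (t : R) : 0 <= t -> cabs t%:C = t.
Proof. by move=> t0; apply: complexI; rewrite -norm_cabs ger0_norm// ler0c. Qed.

Lemma cabsV a : cabs a^-1 = (cabs a)^-1.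
Proof. by apply: complexI; rewrite -norm_cabs normfV norm_cabs fmorphV. Qed.

Lemma cabs_le_ReIm (a : C) : cabs a <= `|complex.Re a| + `|complex.Im a|.
Proof.
rewrite -lecR -norm_cabs [in leLHS](complexE a).
apply: le_trans (ler_normD _ _) _.
rewrite normrM !norm_cabs -rmorphM -rmorphD lecR /=.
have absC (t : R) : cabs t%:C = `|t|.
  by rewrite /cabs normc_def /= expr0n /= addr0 sqrtr_sqr.
have -> : cabs 'i%C = 1 by rewrite /cabs normc_def /= expr0n /= add0r expr1n sqrtr1.
by rewrite mul1r !absC.
Qed.

Lemma Re_le_cabs (a : C) : `|complex.Re a| <= cabs a.
Proof.
rewrite /cabs normc_def /= -sqrtr_sqr; apply: ler_wsqrtr.
by rewrite lerDl sqr_ge0.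
Qed.

Lemma Im_le_cabs (a : C) : `|complex.Im a| <= cabs a.
Proof.
rewrite /cabs normc_def /= -sqrtr_sqr; apply: ler_wsqrtr.
by rewrite lerDr sqr_ge0.
Qed.

Lemma cabs_geometric_cvg (u : nat -> C) (B : R) :
  (forall k, cabs (u k.+1 - u k) <= B * 2^-1 ^+ k) ->
  exists l, forall k, cabs (l - u k) <= B * 4 * 2^-1 ^+ k.
Proof.
move=> hu.
have arch e : 0 < e -> exists k, B * 2 * 2^-1 ^+ k < e by exact: half_pow_arch.
have [|a ha] := @geometric_cvg _ R (fun k => complex.Re (u k)) B arch.
  by move=> k; rewrite -raddfB; apply: le_trans (Re_le_cabs _) (hu k).
have [|b hb] := @geometric_cvg _ R (fun k => complex.Im (u k)) B arch.
  by move=> k; rewrite -raddfB; apply: le_trans (Im_le_cabs _) (hu k).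
exists (a +i* b)%C => k; apply: le_trans (cabs_le_ReIm _) _.
rewrite !raddfB /=; have := ha k; have := hb k; lra.
Qed.

Section NormedSpace.
Context {X : completeNormedModType C}.
Implicit Types (x y : X) (M F : set X).

Definition nrm x : R := complex.Re `|x|.

Lemma nrmE x : `|x| = (nrm x)%:C.
Proof. by rewrite /nrm RRe_real// ger0_real. Qed.

Lemma nrm_ge0 x : 0 <= nrm x.
Proof. by rewrite -ler0c -nrmE. Qed.

Lemma nrmD x y : nrm (x + y) <= nrm x + nrm y.
Proof. by rewrite -lecR rmorphD /= -!nrmE; exact: ler_normD. Qed.

Lemma nrmN x : nrm (- x) = nrm x.
Proof. by rewrite /nrm normrN. Qed.

Lemma nrmB x y : nrm (x - y) <= nrm x + nrm y.
Proof. by rewrite -(nrmN y); exact: nrmD. Qed.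

Lemma nrmC x y : nrm (x - y) = nrm (y - x).
Proof. by rewrite -nrmN opprB. Qed.

Lemma nrm_tri y x z : nrm (x - z) <= nrm (x - y) + nrm (y - z).
Proof. by rewrite -(subrK y x) -addrA [x - y + y]subrK; exact: nrmD. Qed.

Lemma nrmZ a x : nrm (a *: x) = cabs a * nrm x.
Proof. by apply: complexI; rewrite rmorphM /= -nrmE normrZ norm_cabs nrmE. Qed.

Lemma nrm0 : nrm 0 = 0. Proof. by apply: complexI; rewrite -nrmE normr0. Qed.

Lemma nrm_eq0 x : nrm x = 0 -> x = 0.
Proof. by move=> x0; apply/eqP; rewrite -normr_eq0 nrmE x0. Qed.

Lemma nrm_gt0 x : x != 0 -> 0 < nrm x.
Proof.
move=> x0; rewrite lt_neqAle nrm_ge0 andbT eq_sym.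
by apply: contra x0 => /eqP/nrm_eq0->.
Qed.

Lemma nrm_geometric_cvg (u : nat -> X) (B : R) :
  (forall k, nrm (u k.+1 - u k) <= B * 2^-1 ^+ k) ->
  exists l, forall k, nrm (l - u k) <= B * 2 * 2^-1 ^+ k.
Proof.
move=> hu.
have toC (b : R) k : (b * 2^-1 ^+ k)%:C = b%:C * 2^-1 ^+ k.
  by rewrite rmorphM rmorphXn fmorphV rmorph_nat.
have toC2 k : (B * 2 * 2^-1 ^+ k)%:C = B%:C * 2 * 2^-1 ^+ k.
  by rewrite toC rmorphM rmorph_nat.
have [e e0|k|l hl] := @geometric_cvg _ X u B%:C.
- move: e0; rewrite ltcE /= => /andP[/eqP Ie e0].
  have [k hk] := half_pow_arch (B * 2) e0; exists k.
  by rewrite -toC2 (_ : e = (complex.Re e)%:C) ?ltcR//; case: (e) Ie => a b /= ->.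
- by rewrite -toC nrmE lecR.
by exists l => k; have := hl k; rewrite -toC2 nrmE lecR.
Qed.

Definition nclosed M :=
  forall x, (forall e, 0 < e -> exists2 y, M y & nrm (x - y) < e) -> M x.

Lemma closedP M : closed M <-> nclosed M.
Proof.
have ballE x (e : R) y : ball x e%:C y <-> nrm (x - y) < e.
  by rewrite -ball_normE /= nrmE ltcR.
split=> [/closure_id cM x hx|cM].
  rewrite cM => B /nbhs_ballP[e /= e0 eB].
  move: e0; rewrite ltcE /= => /andP[/eqP Ie e0].
  have Ee : e = (complex.Re e)%:C by case: (e) Ie => a b /= ->.
  have [y My xy] := hx _ e0; exists y; split=> //; apply: eB.
  by rewrite Ee; apply/ballE.
apply/closure_id/seteqP; split; first exact: subset_closure.
move=> x hx; apply: cM => e e0.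
have [y [My /ballE xy]] := hx (ball x e%:C) (nbhsx_ballx x e%:C (etrans (ltcR 0 e) e0)).
by exists y.
Qed.

End NormedSpace.
End RealNorm.

(** * Finite-dimensional subspaces and their perturbations *)

Section FiniteDimension.
Context {R : realType} {X : completeNormedModType R[i]}.
Local Notation C := R[i].
Implicit Types (x y v : X) (M F P Q : set X) (u : nat -> X).

Lemma nrm_sum n u : nrm (\sum_(j < n) u j) <= \sum_(j < n) nrm (u j).
Proof.
elim: n => [|n IH]; first by rewrite !big_ord0 nrm0.
by rewrite !big_ord_recr /=; apply: le_trans (nrmD _ _) _; rewrite lerD2r.
Qed.

Lemma nclosed_dist F v : nclosed F -> ~ F v ->
  exists2 d : R, 0 < d & forall f, F f -> d <= nrm (v - f).
Proof.
move=> cF nFv; apply: contrapT => h; apply: nFv; apply: cF => e e0.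
apply: contrapT => h'; apply: h; exists e => // f Ff.
by rewrite leNgt; apply/negP => lt; apply: h'; exists f.
Qed.

Lemma scaled_dist F v (d : R) (a : C) f : lsubspace F ->
  (forall f, F f -> d <= nrm (v - f)) -> F f -> cabs a * d <= nrm (a *: v - f).
Proof.
move=> sF hd Ff; have [->|a0] := eqVneq a 0; first by rewrite cabs0 mul0r nrm_ge0.
rewrite -[f](scalerKV a0) -scalerBr nrmZ; apply: ler_wpM2l; first exact: cabs_ge0.
by apply: hd; exact: lsubspaceZ.
Qed.

(** The distance from [v] to [F] controls the coefficient of [v], so that
    approximating sequences have convergent coefficients. *)
Lemma nclosed_add_line F v : lsubspace F -> nclosed F ->
  nclosed [set x | exists a : C, F (x - a *: v)].
Proof.
move=> sF cF x hx.
have [Fv|nFv] := EM (F v).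
  exists 0; rewrite scale0r subr0; apply: cF => e /hx[y [a Fy] xy]; exists y => //.
  by rewrite -(subrK (a *: v) y); apply: lsubspaceD => //; exact: lsubspaceZ.
have [d d0 hd] := nclosed_dist cF nFv.
have /choice[w hw] : forall k : nat, exists w : X * C,
    F (w.1 - w.2 *: v) /\ nrm (x - w.1) < 2^-1 ^+ k.
  move=> k; have [|y [a Fy] xy] := hx (2^-1 ^+ k); last by exists (y, a).
  by rewrite exprn_gt0 ?invr_gt0.
have [|a ha] := @cabs_geometric_cvg _ (fun k => (w k).2) (2 / d).
  move=> k; have [F0 x0] := hw k; have [F1 x1] := hw k.+1.
  have := scaled_dist ((w k.+1).2 - (w k).2) sF hd (lsubspaceB sF F0 F1).
  rewrite scalerBl.
  have -> : (w k.+1).2 *: v - (w k).2 *: v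
      - ((w k).1 - (w k).2 *: v - ((w k.+1).1 - (w k.+1).2 *: v))
      = (w k.+1).1 - (w k).1.
    set p := _ *: v; set q := _ *: v.
    by rewrite opprB addrACA [p + _]addrC subrK opprB addKr.
  move=> h; rewrite mulrAC ler_pdivlMr//; apply: le_trans h _.
  apply: le_trans (nrm_tri x _ _) _; rewrite [nrm (_ - x)]nrmC.
  apply: le_trans (lerD (ltW x1) (ltW x0)) _.
  rewrite exprS; have : 0 <= 2^-1 ^+ k :> R by rewrite exprn_ge0 ?invr_ge0.
  lra.
exists a; apply: cF => e e0.
have [k hk] := half_pow_arch (1 + 2 / d * 4 * nrm v) e0.
have [Fk xk] := hw k; exists ((w k).1 - (w k).2 *: v) => //.
apply: le_lt_trans hk.
have -> : x - a *: v - ((w k).1 - (w k).2 *: v)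
    = (x - (w k).1) - (a - (w k).2) *: v.
  by rewrite scalerBl !opprB addrACA [RHS]addrACA; congr (_ + _); rewrite addrC.
apply: le_trans (nrmB _ _) _; rewrite nrmZ mulrDl mul1r; apply: lerD; first exact: ltW.
rewrite mulrAC; apply: ler_wpM2r => //; exact: nrm_ge0.
Qed.

Definition span_first n u : set X := [set x | exists c : nat -> C, x = \sum_(j < n) c j *: u j].

Lemma lsubspace_span n u : lsubspace (span_first n u).
Proof.
split; first by exists (fun=> 0); rewrite big1// => j _; rewrite scale0r.
move=> a _ _ [c ->] [d ->]; exists (fun j => a * c j + d j).
rewrite scaler_sumr -big_split; apply: eq_bigr => j _ /=.
by rewrite scalerDl scalerA.
Qed.

Lemma span_sub M n u : lsubspace M -> (forall i, (i < n)%N -> M (u i)) ->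
  span_first n u `<=` M.
Proof.
move=> sM hu _ [c ->]; apply: lsubspace_sum => // j _.
by apply: lsubspaceZ => //; exact: hu.
Qed.

Lemma nclosed_span n u : nclosed (span_first n u).
Proof.
elim: n => [|n IH] x hx.
  exists (fun=> 0); rewrite big_ord0; apply: nrm_eq0; apply/eqP.
  rewrite eq_le nrm_ge0 andbT; apply/ler_addgt0Pr => e e0; rewrite add0r.
  by have [y [c]] := hx _ e0; rewrite big_ord0 => -> ; rewrite subr0 => /ltW.
have [] := nclosed_add_line (v := u n) (lsubspace_span n u) IH (x := x).
  move=> e /hx[y [c ->] xy]; exists (\sum_(j < n.+1) c j *: u j) => //.
  by exists (c n), c; rewrite big_ord_recr /= addrK.
move=> a [c xc]; exists (fun j => if (j < n)%N then c j else a).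
rewrite big_ord_recr /= ltnn -[x](subrK (a *: u n)) xc; congr (_ + _).
by apply: eq_bigr => j _; rewrite ltn_ord.
Qed.

Definition ext_row n (c : 'rV[C]_n) (i : nat) : C := oapp (fun j => c 0 j) 0 (insub i).

Lemma ext_rowE n (c : 'rV[C]_n) (j : 'I_n) : ext_row c j = c 0 j.
Proof. by rewrite /ext_row valK. Qed.

Lemma nclosed_fin_dim F : lsubspace F -> fin_dim F -> nclosed F.
Proof.
move=> sF [n /quot_dimP-/(_ sF lsubspace_set0)[e [eF _ es]]].
pose u i := oapp e 0 (insub i : option 'I_n).
suff -> : F = span_first n u by exact: nclosed_span.
have uE (j : 'I_n) : u j = e j by rewrite /u valK.
apply/seteqP; split=> [x Fx|].
  have [c /= hc] := es _ Fx; exists (ext_row c).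
  move/eqP: hc; rewrite subr_eq0 => /eqP ->.
  by apply: eq_bigr => j _; rewrite ext_rowE uE.
by apply: span_sub => // i lti; have := eF (Ordinal lti); rewrite -uE.
Qed.

(** Riesz's lemma: [f] nearly attains the distance from [v] to [F]. *)
Lemma almost_orthogonal F v : lsubspace F -> nclosed F -> ~ F v ->
  exists f, F f /\ v - f != 0 /\ forall g, F g -> nrm (v - f) <= 2 * nrm (v - f - g).
Proof.
move=> sF cF nFv; have [d d0 hd] := nclosed_dist cF nFv.
pose E := [set nrm (v - f) | f in F].
have E0 : E !=set0 by exists (nrm (v - 0)); exists 0 => //; exact: lsubspace0.
have lbE : lbound E d by move=> _ [f Ff <-]; exact: hd.
have hE : has_inf E by split => //; exists d.
have dE : 0 < inf E by apply: lt_le_trans d0 _; exact: lb_le_inf.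
have [_ [f Ff <-] hf] := inf_adherent dE hE.
exists f; split=> //; split.
  by rewrite subr_eq0; apply/eqP => vf; apply: nFv; rewrite vf.
move=> g Fg; apply: ltW; apply: lt_le_trans hf _.
have : inf E <= nrm (v - f - g).
  apply: ge_inf; first by case: hE.
  by exists (f + g); [exact: lsubspaceD|rewrite opprD addrA].
lra.
Qed.

Definition almost_orth n u := forall i, (i < n)%N ->
  u i != 0 /\ forall c : nat -> C, nrm (u i) <= 2 * nrm (u i - \sum_(j < i) c j *: u j).

Lemma almost_orth_coef n u (c : nat -> C) : almost_orth n u ->
  forall i, (i < n)%N ->
  cabs (c i) * nrm (u i) <= 2 * 3 ^+ n * nrm (\sum_(j < n) c j *: u j).
Proof.
elim: n => // n IH hu i.
have top : cabs (c n) * nrm (u n) <= 2 * nrm (\sum_(j < n.+1) c j *: u j).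
  have [c0|c0] := eqVneq (c n) 0.
    by rewrite c0 cabs0 mul0r mulr_ge0// nrm_ge0.
  have [_ /(_ (fun j => - (c n)^-1 * c j))] := hu n (ltnSn n).
  rewrite -(ler_pM2l (cabs_gt0 c0)) mulrCA -[in leRHS]nrmZ scalerBr scaler_sumr big_ord_recr /=.
  have -> // : c n *: u n - \sum_(j < n) c n *: ((- (c n)^-1 * c j) *: u j) =
      \sum_(j < n) c j *: u j + c n *: u n.
    rewrite addrC -sumrN; congr (_ + _); apply: eq_bigr => j _.
    by rewrite scalerA mulrA mulrN mulfV// mulN1r scaleNr opprK.
have p3 : 1 <= 3 ^+ n :> R by rewrite exprn_ege1// ler1n.
rewrite ltnS leq_eqVlt => /orP[/eqP->|lti].
  apply: le_trans top _; rewrite exprS; apply: ler_wpM2r; first exact: nrm_ge0.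
  lra.
have hun : almost_orth n u by move=> j jn; apply: hu; exact: ltnW.
apply: le_trans (IH hun i lti) _.
have h : nrm (\sum_(j < n) c j *: u j) <= 3 * nrm (\sum_(j < n.+1) c j *: u j).
  move: top; rewrite big_ord_recr /=; set s := \sum_(j < n) _ => top.
  have := nrmB (s + c n *: u n) (c n *: u n); rewrite addrK [nrm (_ *: _)]nrmZ.
  by move: top; lra.
have p0 : 0 <= 2 * 3 ^+ n :> R by lra.
by have := ler_wpM2l p0 h; rewrite exprS; lra.
Qed.

(** Continuing to pick almost orthogonal vectors of [Q], either [Q] is exhausted
    or any length is reached. *)
Lemma almost_orth_or_fin_dim Q k : lsubspace Q ->
  (exists2 m, (m <= k)%N & quot_dim_is Q [set 0] m) \/
  exists u, (forall i, (i < k.+1)%N -> Q (u i)) /\ almost_orth k.+1 u.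
Proof.
move=> sQ.
suff step n : (forall m, (m < n)%N -> ~ quot_dim_is Q [set 0] m) ->
    exists u, (forall i, (i < n)%N -> Q (u i)) /\ almost_orth n u.
  have [[m mk qm]|h] := EM (exists2 m, (m <= k)%N & quot_dim_is Q [set 0] m).
    by left; exists m.
  by right; apply: step => m mk qm; apply: h; exists m.
elim: n => [|n IH] h; first by exists (fun=> 0).
have [|u [uQ uo]] := IH; first by move=> m mn; apply: h; exact: ltnW.
have [Qs|/existsNP[v /not_implyP[Qv nv]]] := EM (Q `<=` span_first n u).
  case: (h n (ltnSn n)); apply/(quot_dimP _ sQ lsubspace_set0).
  exists (fun j : 'I_n => u j); split=> [j|c /= c0|x /Qs[c xc]]; first exact: uQ.
    apply/rowP => j; rewrite mxE; apply: cabs_eq0.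
    have := almost_orth_coef (ext_row c) uo (ltn_ord j).
    have -> : \sum_(j < n) ext_row c j *: u j = 0.
      by rewrite -[RHS]c0; apply: eq_bigr => i _; rewrite ext_rowE.
    have u0 := nrm_gt0 (uo _ (ltn_ord j)).1.
    rewrite nrm0 mulr0 pmulr_lle0// ext_rowE => cj.
    by apply/eqP; rewrite eq_le cj cabs_ge0.
  exists (\row_j c j); rewrite /= xc; apply/eqP; rewrite subr_eq0; apply/eqP.
  by apply: eq_bigr => j _; rewrite mxE.
have [f [Ff [f0 hf]]] := almost_orthogonal (lsubspace_span n u) (@nclosed_span n u) nv.
pose w i := if (i < n)%N then u i else v - f.
have wE (i : nat) (c : nat -> C) : (i <= n)%N ->
    \sum_(j < i) c j *: w j = \sum_(j < i) c j *: u j.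
  by move=> le; apply: eq_bigr => j _; rewrite /w (leq_trans (ltn_ord j)).
exists w; split=> i; rewrite ltnS leq_eqVlt => /orP[/eqP->|lti].
- rewrite /w ltnn; apply: lsubspaceB => //; exact: span_sub Ff.
- by rewrite /w lti; exact: uQ.
- rewrite /w ltnn -/w; split=> // c; rewrite wE//; apply: hf; by exists c.
- have [ui0 hi] := uo _ lti; split; first by rewrite /w lti.
  by move=> c; rewrite wE ?(ltnW lti)// /w lti; exact: hi.
Qed.

(** A subspace all of whose vectors are relatively close to [P] cannot be of
    larger dimension: an almost orthogonal family would be moved into [P]
    without losing its independence. *)
Lemma gap_dim_le P Q n (eps : R) : lsubspace P -> lsubspace Q ->
  quot_dim_is P [set 0] n -> 0 <= eps -> eps * (n.+1%:R * (2 * 3 ^+ n.+1)) < 1 ->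
  (forall q, Q q -> exists2 p, P p & nrm (q - p) <= eps * nrm q) ->
  exists2 m, (m <= n)%N & quot_dim_is Q [set 0] m.
Proof.
move=> sP sQ qP eps0 eps1 near.
have [//|[u [uQ uo]]] := almost_orth_or_fin_dim n sQ.
have /choice[p hp] : forall i : 'I_n.+1, exists p, P p /\ nrm (u i - p) <= eps * nrm (u i).
  by move=> i; have [p Pp up] := near _ (uQ _ (ltn_ord i)); exists p.
have [e [_ _ es]] := (iffLR (quot_dimP _ sP lsubspace_set0)) qP.
suff : (n.+1 <= n)%N by rewrite ltnn.
apply: (@indep_mod_leq _ _ P [set 0] _ _ p e lsubspace_set0 _ _ es).
  by move=> i; case: (hp i).
move=> c /= c0; pose d := ext_row c.
pose s := \sum_(j < n.+1) d j *: u j.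
have sE : s = \sum_j c 0 j *: (u j - p j).
  rewrite (eq_bigr _ (fun j _ => scalerBr _ _ _)) sumrB -/(lincomb p c) c0 subr0.
  by apply: eq_bigr => j _; rewrite /d ext_rowE.
have coef (j : 'I_n.+1) : cabs (c 0 j) * nrm (u j) <= 2 * 3 ^+ n.+1 * nrm s.
  by have := almost_orth_coef d uo (ltn_ord j); rewrite /d ext_rowE.
have sle : nrm s <= eps * (n.+1%:R * (2 * 3 ^+ n.+1)) * nrm s.
  rewrite {1}sE.
  pose g i := if insub i is Some j then c 0 j *: (u j - p j) else 0.
  have -> : \sum_j c 0 j *: (u j - p j) = \sum_(j < n.+1) g j.
    by apply: eq_bigr => j _; rewrite /g valK.
  apply: le_trans (nrm_sum _ _) _.
  have -> : eps * (n.+1%:R * (2 * 3 ^+ n.+1)) * nrm s =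
      \sum_(j < n.+1) eps * (2 * 3 ^+ n.+1 * nrm s).
    by rewrite sumr_const card_ord -mulr_natl; ring.
  apply: ler_sum => j _; rewrite /g valK nrmZ.
  have [_ uj] := hp j.
  apply: le_trans (ler_wpM2l (cabs_ge0 _) uj) _.
  by rewrite mulrCA; exact: ler_wpM2l.
have s0 : nrm s = 0.
  apply/eqP; rewrite eq_le nrm_ge0 andbT leNgt; apply/negP => s0.
  by move: sle; rewrite leNgt gtr_pMl ?eps1.
apply/rowP => j; rewrite mxE; apply: cabs_eq0; apply/eqP.
rewrite eq_le cabs_ge0 andbT -(pmulr_lle0 _ (nrm_gt0 (uo _ (ltn_ord j)).1)).
by have := coef j; rewrite s0 mulr0.
Qed.

Lemma gap_dim_eq P Q n (eps : R) : lsubspace P -> lsubspace Q ->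
  quot_dim_is P [set 0] n -> 0 <= eps -> eps * (n.+1%:R * (2 * 3 ^+ n.+1)) < 1 ->
  (forall q, Q q -> exists2 p, P p & nrm (q - p) <= eps * nrm q) ->
  (forall p, P p -> exists2 q, Q q & nrm (p - q) <= eps * nrm p) ->
  quot_dim_is Q [set 0] n.
Proof.
move=> sP sQ qP eps0 eps1 nQP nPQ.
have [m mn qQ] := gap_dim_le sP sQ qP eps0 eps1 nQP.
suff -> : n = m by [].
have [k km qP'] : exists2 k, (k <= m)%N & quot_dim_is P [set 0] k.
  apply: (gap_dim_le sQ sP qQ eps0 _ nPQ); apply: le_lt_trans eps1.
  apply: ler_wpM2l => //; apply: ler_pM; rewrite ?ler_nat ?mulr_ge0 ?exprn_ge0//.
  by apply: ler_wpM2l => //; rewrite ler_weXn2l// ler1n.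
apply/eqP; rewrite eqn_leq mn andbT.
by rewrite (quot_dim_uniq sP lsubspace_set0 qP qP').
Qed.

End FiniteDimension.

(** * Open mappings and closed ranges *)

Section OpenMapping.
Context {R : realType} {X : completeNormedModType R[i]}.
Local Notation C := R[i].
Implicit Types (x y : X) (M F W : set X) (A B S : {linear X -> X}) (K c : R).

Definition bounded_by K A := 0 <= K /\ forall x, nrm (A x) <= K * nrm x.

(** Bounded preimages modulo [F]: for [F = 0] a form of openness, for [F] a
    complement of the range a bounded solution of [A x + f = y]. *)
Definition lifts_with c M A F :=
  forall y, M y -> exists x, [/\ M x, nrm x <= c * nrm y & F (y - A x)].

(** Baire's theorem inside a closed set: otherwise nested balls, avoiding one
    member of the cover after the other, would shrink to an uncovered point. *)
Lemma nclosed_baire M (E : nat -> set X) y0 : nclosed M -> M y0 ->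
  (forall y, M y -> exists j, E j y) ->
  exists j y1 (r : R), [/\ 0 < r, M y1 & forall y, M y -> nrm (y - y1) < r ->
    forall e, 0 < e -> exists2 z, E j z & nrm (y - z) < e].
Proof.
move=> cM My0 cov; apply: contrapT => nh.
have step (j : nat) (s : X * R) : exists s' : X * R, M s.1 -> 0 < s.2 ->
    [/\ M s'.1, 0 < s'.2, nrm (s'.1 - s.1) + s'.2 <= s.2, s'.2 <= s.2 / 2
      & forall z, E j z -> s'.2 < nrm (s'.1 - z)].
  case: s => y r /=; apply: contrapT => ns.
  have [My r0] : M y /\ 0 < r.
    by split; apply: contrapT => h; apply: ns; exists (y, r).
  apply: nh; exists j, y, (r / 2); split=> // [|y' My' yy' e e0].
    by rewrite divr_gt0.
  apply: contrapT => ne; apply: ns.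
  exists (y', Num.min (r / 2) (e / 2)) => _ _ /=.
  have me : Num.min (r / 2) (e / 2) <= e / 2 by rewrite ge_min lexx orbT.
  have mr : Num.min (r / 2) (e / 2) <= r / 2 by rewrite ge_min lexx.
  split=> //; first by rewrite lt_min !divr_gt0.
    by lra.
  move=> z Ez; rewrite ltNge; apply/negP => yz; apply: ne; exists z => //.
  lra.
have [g hg] := choice (fun p : nat * (X * R) => step p.1 p.2).
pose s j := iteri j (fun i t => g (i, t)) (y0, 1 : R).
have inv j : M (s j).1 /\ 0 < (s j).2.
  elim: j => [|j [Mj rj]]; first by split.
  by have [] := hg (j, s j) Mj rj.
have st j : [/\ M (s j.+1).1, 0 < (s j.+1).2, nrm ((s j.+1).1 - (s j).1) + (s j.+1).2 <= (s j).2,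
    (s j.+1).2 <= (s j).2 / 2 & forall z, E j z -> (s j.+1).2 < nrm ((s j.+1).1 - z)].
  by have [Mj rj] := inv j; exact: (hg (j, s j) Mj rj).
have rle j : (s j).2 <= 2^-1 ^+ j.
  elim: j => [|j IH]; first by rewrite expr0.
  by have [_ _ _ h _] := st j; rewrite exprS; move: h IH; lra.
have nest j i : nrm ((s (j + i)%N).1 - (s j).1) + (s (j + i)%N).2 <= (s j).2.
  elim: i => [|i IH]; first by rewrite addn0 subrr nrm0 add0r.
  have [_ _ h _ _] := st (j + i)%N; rewrite addnS.
  have := nrm_tri (s (j + i)%N).1 (s (j + i).+1).1 (s j).1; lra.
have [|l hl] := @nrm_geometric_cvg _ X (fun j => (s j).1) 1.
  move=> k; rewrite mul1r; have [_ r1 h _ _] := st k; have := rle k; lra.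
have lle j : nrm (l - (s j).1) <= (s j).2.
  apply/ler_addgt0Pr => e e0; have [k hk] := half_pow_arch 2 e0.
  have h1 := hl (j + k)%N; have h2 := nest j k.
  have h3 := nrm_tri (s (j + k)%N).1 l (s j).1.
  have [_ h4] := inv (j + k)%N.
  have h5 : 2^-1 ^+ (j + k) <= 2^-1 ^+ k :> R.
    rewrite exprD ler_piMl ?exprn_ge0 ?invr_ge0// exprn_ile1 ?invr_ge0//.
    by rewrite invf_le1 ?ler1n.
  lra.
have Ml : M l.
  apply: cM => e e0; have [k hk] := half_pow_arch 2 e0.
  exists (s k).1; first by have [] := inv k.
  by have := hl k; lra.
have [j Ej] := cov _ Ml; have [_ _ _ _ /(_ _ Ej)] := st j.
by rewrite nrmC ltNge lle.
Qed.

(** Successive approximation: halving the error at each step sums up to an exact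
    solution modulo [F]. *)
Lemma lift_of_approx K c W M A F : nclosed M -> lsubspace M -> nclosed F ->
  lsubspace F -> bounded_by K A ->
  (forall y, W y -> exists x f, [/\ M x, nrm x <= c * nrm y, F f,
      W (y - A x - f) & nrm (y - A x - f) <= nrm y / 2]) ->
  forall y, W y -> exists x, [/\ M x, nrm x <= 2 * c * nrm y & F (y - A x)].
Proof.
move=> cM sM cF sF [K0 hK] happ y Wy.
have /choice[g hg] : forall w, exists p : X * X, W w -> [/\ M p.1, nrm p.1 <= c * nrm w, F p.2,
      W (w - A p.1 - p.2) & nrm (w - A p.1 - p.2) <= nrm w / 2].
  move=> w; have [/happ[x [f h]]|nW] := EM (W w); first by exists (x, f).
  by exists (0, 0) => /nW.
pose r w := w - A (g w).1 - (g w).2.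
pose v k := iter k r y.
have Wv k : W (v k) by elim: k => //= k /hg[].
have vle k : nrm (v k) <= nrm y * 2^-1 ^+ k.
  elim: k => [|k IH]; first by rewrite mulr1.
  by have [_ _ _ _] := hg _ (Wv k); rewrite -/(r _) -[r _]/(v k.+1) exprS; lra.
pose s k := \sum_(j < k) (g (v j)).1.
have sS k : s k.+1 = s k + (g (v k)).1 by rewrite /s big_ord_recr.
have c0 : 0 <= c * nrm y.
  by have [_ h _ _ _] := hg _ Wy; apply: le_trans h; exact: nrm_ge0.
have step k : nrm (s k.+1 - s k) <= c * nrm y * 2^-1 ^+ k.
  rewrite sS addrC addKr; have [_ h _ _ _] := hg _ (Wv k).
  have [cpos|cneg] := leP 0 c.
    by have := ler_wpM2l cpos (vle k); lra.
  have y0 : nrm y = 0.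
    apply/eqP; rewrite eq_le nrm_ge0 andbT leNgt; apply/negP => ypos.
    by move: c0; rewrite pmulr_lge0// leNgt cneg.
  have v0 : nrm (v k) = 0.
    by apply/eqP; rewrite eq_le nrm_ge0 andbT; have := vle k; rewrite y0 mul0r.
  by move: h; rewrite v0 y0 !mulr0 mul0r.
have [l hl] := nrm_geometric_cvg step.
have Ms k : M (s k) by apply: lsubspace_sum => // j _; case: (hg _ (Wv j)).
have Fs k : F (y - A (s k) - v k).
  elim: k => [|k IH].
    by rewrite /s big_ord0 linear0 subr0 subrr; exact: lsubspace0.
  have [_ _ Ff _ _] := hg _ (Wv k).
  have -> : y - A (s k.+1) - v k.+1 = (y - A (s k) - v k) + (g (v k)).2.
    rewrite sS linearD /v /= -/(v k) /r.
    set a := A (s k); set b := A _; set d := (g _).2.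
    by rewrite (opprD a b) (opprB (v k - b) d) (opprB (v k) b) [d + _]addrC !addrA subrK.
  exact: lsubspaceD.
exists l; split.
- apply: cM => e e0; have [k hk] := half_pow_arch (c * nrm y * 2) e0.
  by exists (s k) => //; apply: le_lt_trans hk.
- by have := hl 0%N; rewrite /s big_ord0 subr0 mulr1; lra.
- apply: cF => e e0.
  have [k hk] := half_pow_arch (K * (c * nrm y * 2) + nrm y) e0.
  exists (y - A (s k) - v k) => //; apply: le_lt_trans hk.
  have -> : y - A l - (y - A (s k) - v k) = v k - A (l - s k).
    rewrite (linearB A); set a := A l; set b := A _.
    rewrite (opprB (y - b)) (opprB y b) (opprB a b) addrCA; congr (_ + _).
    by rewrite [y - a]addrC addrACA subrr addr0 addrC.
  apply: le_trans (nrmB _ _) _; have := hK (l - s k).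
  by have := ler_wpM2l K0 (hl k); have := vle k; lra.
Qed.

(** The open mapping theorem for the sum map [(x, f) |-> A x + f]: by Baire the
    vectors with preimages of bounded norm are dense in a ball of [M], which after
    translation and scaling gives approximate preimages of every vector. *)
Lemma open_mapping K M A F : nclosed M -> lsubspace M -> nclosed F -> lsubspace F ->
  F `<=` M -> bounded_by K A -> (forall x, M x -> M (A x)) ->
  (forall y, M y -> exists2 x, M x & F (y - A x)) ->
  exists2 c, 0 <= c & lifts_with c M A F.
Proof.
move=> cM sM cF sF FM bA AM onto.
pose E (j : nat) := [set y | M y /\ exists x, [/\ M x, nrm x <= j%:R & F (y - A x)]].
have [y My|j [y1 [r [r0 My1 dens]]]] := @nclosed_baire M E 0 cM (lsubspace0 sM).
  have [x Mx Fx] := onto y My; exists (Num.Def.trunc (nrm x)).+1; split=> //; exists x; split=> //.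
  by apply: ltW; exact: truncnS_gt.
pose c := 2 * j%:R / (r / 2).
have r2 : 0 < r / 2 by rewrite divr_gt0.
have c0 : 0 <= c by apply: divr_ge0; [exact: mulr_ge0|exact: ltW].
exists (2 * c); first by rewrite mulr_ge0.
apply: (lift_of_approx cM sM cF sF bA) => y My.
have [y0|y0] := eqVneq y 0.
  exists 0, 0; rewrite y0 linear0 !subr0 nrm0 mulr0 mul0r.
  by split=> //; exact: lsubspace0.
have ny := nrm_gt0 y0.
(* [t] scales [y] to half the radius of the ball *)
pose t := r / 2 / nrm y; have t0 : 0 < t by rewrite !divr_gt0.
have tC : t%:C != 0 :> C by rewrite -(rmorph0 (real_complex R)) (inj_eq (@complexI R)) gt_eqF.
have ct : cabs (t%:C) = t by rewrite cabs_real// ltW.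
have tny : t * nrm y = r / 2 by rewrite /t mulfVK// gt_eqF.
have r8 : 0 < r / 8 by rewrite divr_gt0.
have [|z1 [Mz1 [x1 [Mx1 nx1 Fx1]]] yz1] := dens y1 My1 _ (r / 8) r8.
  by rewrite subrr nrm0.
have My2 : M (y1 + t%:C *: y) by apply: lsubspaceD => //; exact: lsubspaceZ.
have [|z2 [Mz2 [x2 [Mx2 nx2 Fx2]]] yz2] := dens _ My2 _ (r / 8) r8.
  by rewrite addrC addKr nrmZ ct tny; lra.
exists ((t%:C)^-1 *: (x2 - x1)), ((t%:C)^-1 *: (z2 - A x2 - (z1 - A x1))).
set x := _ *: (x2 - x1); set f := _ *: (_ - _ - _).
have E1 : y - A x - f = (t%:C)^-1 *: ((y1 + t%:C *: y - z2) - (y1 - z1)).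
  have -> : y - A x - f = (t%:C)^-1 *: (t%:C *: y - (A (x2 - x1) + (z2 - A x2 - (z1 - A x1)))).
    by rewrite scalerBr scalerDr scalerK// -(linearZ_LR A) opprD addrA.
  congr (_ *: _); rewrite (linearB A).
  set a := A x2; set b := A x1; set w := _ *: y.
  have -> : a - b + (z2 - a - (z1 - b)) = z2 - z1.
    by rewrite (opprB z1 b) addrC addrACA subrK [b - z1 - b]addrAC subrr sub0r.
  rewrite (opprB z2 z1) (opprB y1 z1) [y1 + w]addrC [w + y1 - z2]addrAC addrACA.
  by rewrite subrr addr0 -addrA [- z2 + z1]addrC.
have MF : M f by apply: FM; apply: lsubspaceZ => //; exact: lsubspaceB.
have Mx : M x by apply: lsubspaceZ => //; exact: lsubspaceB.
have Ff : F f by apply: lsubspaceZ => //; exact: lsubspaceB.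
split=> //.
- rewrite nrmZ cabsV ct mulrC ler_pdivrMr// -mulrA [nrm y * t]mulrC tny.
  rewrite /c mulfVK ?gt_eqF ?divr_gt0//.
  by have := nrmB x2 x1; lra.
- by apply: lsubspaceB => //; apply: lsubspaceB => //; exact: AM.
rewrite E1 nrmZ cabsV ct mulrC ler_pdivrMr// mulrAC [nrm y * t]mulrC tny.
have := nrmB (y1 + t%:C *: y - z2) (y1 - z1); lra.
Qed.

Lemma nclosed_set0 : nclosed [set (0 : X)].
Proof.
apply: nclosed_fin_dim; first exact: lsubspace_set0.
by exists 0%N; apply/(quot_dim0 lsubspace_set0 lsubspace_set0).
Qed.

(** Kato: a range of finite codimension is closed. A complement [F] makes the
    sum map onto, and lifts of vectors of the range stay exact because [F] meets
    the range trivially; so limits of the range can be lifted too. *)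
Lemma nclosed_range_fin_codim K M A : nclosed M -> lsubspace M -> bounded_by K A ->
  (forall x, M x -> M (A x)) -> fin_codim_in M (A @` M) -> nclosed (A @` M).
Proof.
move=> cM sM bA AM [n qn].
have sI := lsubspace_image A sM.
have [F [sF FM qF FI Fs]] := fin_codim_complement sM sI qn.
have cF : nclosed F by apply: nclosed_fin_dim => //; exists n.
have [y My|c c0 lift] := open_mapping cM sM cF sF FM bA AM.
  by have [f Ff [x Mx fx]] := Fs _ My; exists x; rewrite // fx opprB addrC subrK.
pose W := [set y | forall e, 0 < e -> exists2 z, (A @` M) z & nrm (y - z) < e].
move=> y Wy.
have [y' Wy'|x [Mx _ /= yx]] := @lift_of_approx K (2 * c) W M A [set 0] cM sM nclosed_set0
  lsubspace_set0 bA _ y Wy.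
  have [y0|y0] := eqVneq y' 0.
    exists 0, 0; rewrite y0 linear0 !subr0 nrm0 mulr0 mul0r; split=> //.
    - exact: lsubspace0.
    - by rewrite -y0.
  have y2 : 0 < nrm y' / 2 by rewrite divr_gt0// nrm_gt0.
  have [_ [x0 Mx0 <-] yz] := Wy' _ y2.
  have [x [Mx nx Fx]] := lift _ (AM _ Mx0).
  have Ax : A x = A x0.
    apply/esym/eqP; rewrite -subr_eq0; apply/eqP; apply: FI; split=> //.
    by apply: lsubspaceB => //; [exists x0|exists x].
  exists x, 0; rewrite Ax subr0; split=> //; last exact: ltW.
    apply: le_trans nx _; rewrite -mulrA mulrCA; apply: ler_wpM2l => //.
    have := nrm_tri y' (A x0) 0; rewrite !subr0 [nrm (A x0 - _)]nrmC.
    by have := nrm_ge0 y'; move: yz; lra.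
  move=> e e0; have [z Iz hz] := Wy' _ e0.
  exists (z - A x0); first by apply: lsubspaceB => //; exists x0.
  by rewrite opprB addrA subrK.
by exists x => //; apply/esym/eqP; rewrite -subr_eq0 yx.
Qed.

(** * Small perturbations *)

Lemma lifts_with_perturb K c M A B F (mu : C) : nclosed M -> lsubspace M ->
  nclosed F -> lsubspace F -> bounded_by K B ->
  (forall x, B x = A x - mu *: x) -> cabs mu * c <= 2^-1 ->
  lifts_with c M A F -> lifts_with (2 * c) M B F.
Proof.
move=> cM sM cF sF bB hB small lift; apply: (lift_of_approx cM sM cF sF bB) => y My.
have [x [Mx nx Fx]] := lift _ My; exists x, (y - A x).
have -> : y - B x - (y - A x) = mu *: x.
  by rewrite hB (opprB y) (opprB (A x)) [y + _]addrC addrACA subrK subrr addr0.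
split=> //; first exact: lsubspaceZ.
rewrite nrmZ; apply: le_trans (ler_wpM2l (cabs_ge0 _) nx) _.
rewrite mulrA [leRHS]mulrC; apply: ler_wpM2r => //; exact: nrm_ge0.
Qed.

Lemma preimage_near c M A B F (mu : C) k : lsubspace M -> lsubspace F ->
  lifts_with c M A F -> (forall x, B x = A x - mu *: x) -> M k -> F (B k) ->
  exists2 x, M x /\ F (A x) & nrm (k - x) <= c * cabs mu * nrm k.
Proof.
move=> sM sF lift hB Mk Fk.
have [z [Mz nz Fz]] := lift _ (lsubspaceZ mu sM Mk).
exists (k - z); last by rewrite opprB addrC subrK -mulrA -nrmZ.
split; first exact: lsubspaceB.
have -> : A (k - z) = B k + (mu *: k - A z) by rewrite (linearB A) hB addrA subrK.
exact: lsubspaceD.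
Qed.

Lemma bounded_by_shift K A B (mu : C) : bounded_by K A ->
  (forall x, B x = A x - mu *: x) -> bounded_by (K + cabs mu) B.
Proof.
move=> [K0 hK] hB; split=> [|x]; first by rewrite addr_ge0// cabs_ge0.
by rewrite hB mulrDl -nrmZ; apply: le_trans (nrmB _ _) _; rewrite lerD2r.
Qed.

(** With a complement [F] of [A M], the preimage of [F] under [A - mu] stays
    close to the kernel of [A], hence keeps its dimension. *)
Lemma is_weyl_perturb K M A : nclosed M -> lsubspace M -> bounded_by K A ->
  (forall x, M x -> M (A x)) -> is_weyl M A ->
  exists2 d : R, 0 < d & forall (mu : C) B, cabs mu < d ->
    (forall x, B x = A x - mu *: x) -> is_weyl M B.
Proof.
move=> cM sM bA AM [n [qN qI]].
have sI := lsubspace_image A sM.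
have [F [sF FM qF FI Fs]] := fin_codim_complement sM sI qI.
have cF : nclosed F by apply: nclosed_fin_dim => //; exists n.
have [y My|c c0 lift] := open_mapping cM sM cF sF FM bA AM.
  by have [f Ff [x Mx fx]] := Fs _ My; exists x; rewrite // fx opprB addrC subrK.
pose G : R := n.+1%:R * (2 * 3 ^+ n.+1).
have G0 : 0 <= G by rewrite !mulr_ge0 ?exprn_ge0.
have cG : 0 <= c * G by rewrite mulr_ge0.
have D0 : 0 < 2 * c * G + 2 * c + 1 by lra.
(* [2 * c] keeps the bounded lifts for [A - mu], [2 * c * G] makes the gap small *)
exists (2 * c * G + 2 * c + 1)^-1; first by rewrite invr_gt0.
move=> mu B mud hB.
have m0 := cabs_ge0 mu.
have prod : cabs mu * (2 * c * G + 2 * c + 1) < 1.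
  by rewrite -ltr_pdivlMr// div1r.
have mcG : 0 <= cabs mu * (c * G) by rewrite mulr_ge0.
have mc : 0 <= cabs mu * c by rewrite mulr_ge0.
have liftB : lifts_with (2 * c) M B F.
  by apply: (lifts_with_perturb cM sM cF sF (bounded_by_shift bA hB) hB _ lift); lra.
have BM x : M x -> M (B x).
  by move=> Mx; rewrite hB; apply: lsubspaceB => //; [exact: AM|exact: lsubspaceZ].
have hA x : A x = B x - (- mu) *: x by rewrite hB scaleNr opprK subrK.
have cN : cabs (- mu) = cabs mu by rewrite /cabs normrN.
apply: (is_weyl_of_preimage sM sF BM FM _ qF).
  by move=> y My; have [x [Mx _ Fx]] := liftB _ My; exists x.
apply: (gap_dim_eq (eps := 2 * c * cabs mu) (lsubspace_nullI A sM) _ qN).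
- split; first by rewrite /= linear0; split; exact: lsubspace0.
  move=> a x y [Mx Fx] [My Fy]; split.
    by apply: lsubspaceD => //; exact: lsubspaceZ.
  by rewrite linearP; apply: lsubspaceD => //; exact: lsubspaceZ.
- by rewrite !mulr_ge0.
- by rewrite -/G; lra.
- move=> x [Mx Fx]; have [z [Mz Fz] xz] := preimage_near sM sF lift hB Mx Fx.
  exists z; first by split=> //; apply: FI; split=> //; exists z.
  by apply: le_trans xz _; apply: ler_wpM2r; [exact: nrm_ge0|lra].
move=> x [Ax Mx].
have [|z Dz xz] := preimage_near sM sF liftB hA Mx _.
  by rewrite Ax; exact: lsubspace0.
by exists z => //; rewrite -cN.
Qed.

Lemma nclosed_ranges K S n : bounded_by K S -> nclosed (range (iter n S)) ->
  is_weyl (range (iter n S)) S -> forall k, nclosed (range (iter (n + k) S)).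
Proof.
move=> bS cn wn; elim=> [|k IH]; first by rewrite addn0.
have [m [_ qm]] := is_weyl_range_le k wn.
rewrite addnS range_iterS; apply: (nclosed_range_fin_codim IH _ bS).
- exact: lsubspace_range.
- exact: range_iter_stable.
- by exists m.
Qed.

(** If all ranges met the kernel nontrivially, the hyperrange would be a Banach
    space mapped onto itself with a kernel; this persists for [S - mu] with [mu]
    small, which is still of index zero but then has infinite ascent. The family
    [shift] allows any presentation of the operators [S - mu]. *)
Lemma bweyl_ascent K S (shift : C -> {linear X -> X}) n :
  (forall mu x, shift mu x = S x - mu *: x) -> bounded_by K S -> nclosed (range (iter n S)) ->
  is_weyl (range (iter n S)) S ->
  (forall (mu : C) k, mu != 0 -> weyl (shift mu) -> k != 0 -> shift mu k = 0 ->
    ascent (shift mu) <> None) ->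
  exists p, nullspace S `&` range (iter p S) `<=` [set 0].
Proof.
move=> hshift bS cn wn hyp; pose H := hyperrange S.
have [q nq hq] : exists2 q, (n <= q)%N & forall r, (q <= r)%N ->
    nullspace S `&` range (iter r S) = nullspace S `&` range (iter q S).
  by apply: kernel_range_stabilizes; have [m [qm _]] := wn; exists m.
exists q => k [Sk qk]; apply: contrapT => /= /eqP k0.
have Hk : H k.
  move=> r; apply: (range_iter_le (leq_maxr q r)).
  have /seteqP[_ sub] := hq _ (leq_maxl q r).
  by have [] := sub k (conj Sk qk).
have sH := lsubspace_hyperrange S.
have cH : nclosed H.
  move=> x hx r; apply: (range_iter_le (leq_addl n r)).
  by apply: (nclosed_ranges bS cn wn) => e /hx[y Hy xy]; exists y.
have s0 := @lsubspace_set0 _ X.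
have [y Hy|c c0 lift] := open_mapping cH sH nclosed_set0 s0 (set0_sub sH) bS
  (@hyperrange_stable _ _ S).
  by have [x Hx Sx] := hyperrange_onto hq Hy; exists x; rewrite //= Sx subrr.
have [d d0 wd] := is_weyl_perturb cn (lsubspace_range S n) bS (@range_iter_stable _ _ S n) wn.
(* small enough for the index on [M] and for the lifts into the hyperrange *)
pose t := Num.min (d / 2) (2 * (2 * c + 1))^-1.
have t0 : 0 < t by rewrite lt_min divr_gt0//= invr_gt0; lra.
have td : t < d.
  have : t <= d / 2 by rewrite ge_min lexx.
  by lra.
have tc : t * (2 * (2 * c + 1)) <= 1.
  rewrite -ler_pdivlMr ?div1r; last by lra.
  by rewrite ge_min lexx orbT.
have tc0 : 0 <= t * c by rewrite mulr_ge0// ltW.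
pose mu : C := t%:C; have ct : cabs mu = t by rewrite cabs_real// ltW.
have mu0 : mu != 0 by rewrite -(rmorph0 (real_complex R)) (inj_eq (@complexI R)) gt_eqF.
pose B := shift mu; have hB x : B x = S x - mu *: x by exact: hshift.
have wB : weyl B by apply: (is_weyl_shift mu0 hB); apply: wd hB; rewrite ct.
have liftB : lifts_with (2 * c) H B [set 0].
  apply: (lifts_with_perturb cH sH nclosed_set0 s0 (bounded_by_shift bS hB) hB _ lift).
  by rewrite ct; lra.
have hS x : S x = B x - (- mu) *: x by rewrite hB scaleNr opprK subrK.
have cN : cabs (- mu) = t by rewrite -ct /cabs normrN.
have [x [Hx /= Bx] kx] := preimage_near sH s0 liftB hS Hk Sk.
have x0 : x != 0.
  apply/eqP => x0; move: kx; rewrite x0 subr0 cN leNgt gtr_pMl ?nrm_gt0//.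
  by move=> /negP; apply; lra.
have /eqP := x0; apply.
apply: (onto_kernel_ascent Hx Bx _ (hyp mu x mu0 wB x0 Bx)).
move=> y Hy; have [z [Hz _ /= yz]] := liftB _ Hy; exists z => //.
by apply/esym/eqP; rewrite -subr_eq0 yz.
Qed.

End OpenMapping.

(** * Spectra, poles and left poles *)

Section Spectra.
Context {R : realType} {X : completeNormedModType R[i]}.
Local Notation C := R[i].
Implicit Types (S T : {linear X -> X}) (l : C).

Lemma bounded_by_sub_scalar T l : bounded_op T -> exists K, bounded_by K (sub_scalar T l).
Proof.
move=> [M [M0 hM]]; exists (complex.Re M + cabs l).
apply: (@bounded_by_shift _ _ _ T _ l) => //.
have ME : M = (complex.Re M)%:C by rewrite RRe_real// ger0_real.
split=> [|x]; first by rewrite -ler0c -ME.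
by rewrite -lecR rmorphM /= -ME -!nrmE.
Qed.

Lemma invertible_weyl S : invertible_op S -> weyl S.
Proof.
move=> [U [_ SU US]]; apply/weyl_onP => //; exists 0%N.
have sN := lsubspace_nullI S (@lsubspaceT _ X).
split; first apply/(quot_dim0 sN lsubspace_set0).
  by move=> x [Sx _] /=; rewrite -[x]SU Sx linear0.
apply/(quot_dim0 lsubspaceT (lsubspace_image S lsubspaceT)) => y _.
by exists (U y) => //; exact: US.
Qed.

Lemma invertible_inj S k : invertible_op S -> S k = 0 -> k = 0.
Proof. by move=> [U [_ SU _]] Sk; rewrite -[k]SU Sk linear0. Qed.

Lemma bounded_below_inj S x : bounded_below S -> S x = 0 -> x = 0.
Proof.
move=> [c [c0 hc]] Sx; apply/eqP; rewrite -normr_eq0 eq_le normr_ge0 andbT.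
by have := hc x; rewrite Sx normr0 pmulr_rle0.
Qed.

Lemma bounded_below_onto_invertible S : bounded_below S ->
  (forall y, exists x, S x = y) -> invertible_op S.
Proof.
move=> bb /choice[U hU].
have inj x y : S x = S y -> x = y.
  move=> Sxy; apply/eqP; rewrite -subr_eq0; apply/eqP.
  by apply: (bounded_below_inj bb); rewrite linearB Sxy subrr.
have Ulin : linear U by move=> a x y; apply: inj; rewrite linearP !hU.
pose UL : {linear X -> X} := HB.pack U (GRing.isLinear.Build _ _ _ _ U Ulin).
exists UL; split.
- have [c [c0 hc]] := bb; exists c^-1; split=> [|x]; first by rewrite invr_ge0 ltW.
  by rewrite mulrC ler_pdivlMr// mulrC -{2}(hU x).
- by move=> x; apply: inj; exact: hU.
- exact: hU.
Qed.

Lemma weyl_bweyl S : weyl S -> bweyl S.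
Proof.
by move=> wS; exists 0%N; rewrite range_iter0; split=> //; exact: closedT.
Qed.

Lemma bweyl_ascent_descent S : bweyl S -> ascent S <> None -> descent S <> None.
Proof.
move=> [n [_ /(weyl_onP _ (lsubspace_range S n)) wn]] /ascent_finP[p hp].
exact/descent_finP/(weyl_ascent_descent wn hp).
Qed.

Lemma weyl_fin_dim S : weyl S -> fin_dim (nullspace S).
Proof. by move=> [[h _] _]; rewrite -[nullspace S]setIT. Qed.

(** Finite ascent forces finite descent, so all late ranges coincide with a
    closed one; and an operator of finite descent that is bounded below is
    onto. *)
Lemma bweyl_left_pole T l : bounded_op T -> spectrum T l ->
  bweyl (sub_scalar T l) -> ascent (sub_scalar T l) <> None -> left_pole T l.
Proof.
move=> bT sl bw fa; set S := sub_scalar T l in bw fa *.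
have [d hd] := (iffLR (descent_finP S)) (bweyl_ascent_descent bw fa).
split.
  move=> bb; apply: sl; apply: (bounded_below_onto_invertible bb) => y.
  have := @descent_le_ascent _ _ S 0 d _ hd 1 isT; rewrite range_iter0 => E.
  have : range (iter 1 S) y.
    by rewrite E// => x [Sx _]; exact: bounded_below_inj bb Sx.
  by move=> [x _ <-]; exists x.
case Ea : (ascent S) => [a|//]; exists a; split=> //.
have stab := descent_le_ascent (ascent_Some Ea) hd.
have [n [cn /(weyl_onP _ (lsubspace_range S n)) wn]] := bw.
have [K bK] := bounded_by_sub_scalar l bT.
apply/closedP; rewrite stab// -(stab (n + a)%N) ?leq_addl//.
by apply: (nclosed_ranges bK) => //; apply/closedP.
Qed.

Lemma Pi0_weyl T l : Pi0 T l -> weyl (sub_scalar T l).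
Proof. by move=> [[_ fa fd] fr]; exact: pole_finite_rank_weyl. Qed.

Lemma weyl_ascent_Pi0 T l : spectrum T l -> weyl (sub_scalar T l) ->
  ascent (sub_scalar T l) <> None -> Pi0 T l.
Proof.
move=> sl wl fa; split; last exact: weyl_fin_dim.
by split=> //; exact: weyl_ascent_finite_descent.
Qed.

Lemma left_pole_ascent T l : left_pole T l -> ascent (sub_scalar T l) <> None.
Proof. by move=> [_ [a [-> _]]]. Qed.

Lemma weyl_spectrum_subset T l : weyl_spectrum T l -> spectrum T l.
Proof. by move=> nw /invertible_weyl. Qed.

Lemma setD_weylP T l : (spectrum T `\` weyl_spectrum T) l <->
  spectrum T l /\ weyl (sub_scalar T l).
Proof. by split=> -[sl]; [move=> /contrapT|move=> wl; split=> // nw; exact: nw]. Qed.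

Lemma setD_bweylP T l : (spectrum T `\` bweyl_spectrum T) l <->
  spectrum T l /\ bweyl (sub_scalar T l).
Proof. by split=> -[sl]; [move=> /contrapT|move=> wl; split=> // nw; exact: nw]. Qed.

(** The Weyl points near a B-Weyl point [l] of the spectrum are left poles and
    have finite ascent, hence so has [T - l]. *)
Lemma Z_Pi_a_bweyl T : bounded_op T -> property_Z_Pi_a T ->
  bweyl_spectrum T = weyl_spectrum T.
Proof.
move=> bT Z; apply/seteqP; split=> l; first by move=> nbw /weyl_bweyl.
move=> nw bw; apply: (nw); have sl := weyl_spectrum_subset nw.
suff : (spectrum T `\` weyl_spectrum T) l by move=> /setD_weylP[].
rewrite Z; apply: bweyl_left_pole => //; apply/ascent_finP.
have [n [/closedP cn /(weyl_onP _ (lsubspace_range _ n)) wn]] := bw.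
have [K bK] := bounded_by_sub_scalar l bT.
apply: (bweyl_ascent (shift := fun mu => sub_scalar T (l + mu)) _ bK cn wn).
  by move=> mu x; rewrite !sub_scalarE scalerDl opprD addrA.
move=> mu k _ wmu k0 ker; apply: left_pole_ascent.
suff : (spectrum T `\` weyl_spectrum T) (l + mu) by rewrite Z.
apply/setD_weylP; split=> // inv.
by have := invertible_inj inv ker; move/eqP: k0.
Qed.

End Spectra.

Theorem theorem2p10 (R : realType) (X : completeNormedModType (complex R))
    (X_infdim : ~ fin_dim [set: X]%classic)
    (T : {linear X -> X}%R) (T_bounded : bounded_op T) :
  [<-> property_Z_Pi_a T;
       property_gab T /\ bweyl_spectrum T = weyl_spectrum T;
       property_ab T /\ Pi_a T = Pi_a0 T;
       property_Bab T /\ Pi_a T = Pi_a0 T;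
       browder_theorem T /\ Pi_a T = Pi0 T].
Proof.
tfae.
- move=> Z; have BW := Z_Pi_a_bweyl T_bounded Z; split=> //.
  by rewrite /property_gab BW.
- move=> [gab BW].
  have Z : spectrum T `\` weyl_spectrum T = Pi_a T by rewrite -BW.
  have E : Pi_a T = Pi_a0 T.
    apply/seteqP; split=> l; last by case.
    move=> pl; split=> //; move: pl; rewrite -Z => /setD_weylP[_ wl].
    exact: weyl_fin_dim.
  by split=> //; rewrite /property_ab Z.
- move=> [ab E]; have Z : property_Z_Pi_a T by rewrite /property_Z_Pi_a ab.
  by split=> //; rewrite /property_Bab (Z_Pi_a_bweyl T_bounded Z).
- move=> [Bab E].
  have sub l : spectrum T l -> weyl (sub_scalar T l) -> Pi_a T l.
    move=> sl wl; suff : (spectrum T `\` bweyl_spectrum T) l by rewrite Bab => -[].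
    by apply/setD_bweylP; split=> //; exact: weyl_bweyl.
  have B : browder_theorem T.
    apply/seteqP; split=> l.
      move=> /setD_weylP[sl wl]; apply: weyl_ascent_Pi0 => //.
      exact: left_pole_ascent (sub _ sl wl).
    by move=> pl; apply/setD_weylP; split; [case: pl => -[]|exact: Pi0_weyl].
  split=> //; apply/seteqP; split=> l; last first.
    by move=> pl; apply: sub; [case: pl => -[]|exact: Pi0_weyl].
  move=> pa; have fa := left_pole_ascent pa; move: pa.
  rewrite E => -[pa fr]; split=> //.
  have : (spectrum T `\` bweyl_spectrum T) l by rewrite Bab.
  move=> /setD_bweylP[sl bl]; split=> //; exact: bweyl_ascent_descent.
- by move=> [B E]; rewrite /property_Z_Pi_a E.
Qed.
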